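(* For every $n\geq 2$, $FO(\mathbf{\Sigma}^0_1(\mathbb{R}^n))\equiv_m FO(\mathbb{N}_2)$.
   Context: $\mathbb{R}^n$ carries the Euclidean topology. $\mathbf{\Sigma}^0_1(X)$ denotes the lattice of all open subsets of $X$ (signature $\{\subseteq\}$), $FO(\mathbb{A})$ the set of first-order sentences true in $\mathbb{A}$, and $\equiv_m$ many-one equivalence (mutual many-one reducibility). $\mathbb{N}_2=(\omega\cup P(\omega);\omega,P(\omega),\in,+,\times)$ is the structure of second-order arithmetic. *)

(* Defs.v *)
From Stdlib Require Import Reals List Arith.
From Stdlib Require Vectors.Fin.
Import ListNotations.
Set Implicit Arguments.

Inductive form (Sg : Type) : Type :=
| fEq  : nat -> nat -> form Sg
| fRel : Sg -> list nat -> form Sg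
| fFalse : form Sg
| fNot : form Sg -> form Sg
| fAnd : form Sg -> form Sg -> form Sg
| fOr  : form Sg -> form Sg -> form Sg
| fImp : form Sg -> form Sg -> form Sg
| fAll : form Sg -> form Sg
| fEx  : form Sg -> form Sg.
Arguments fFalse {Sg}.

Fixpoint wf (Sg : Type) (ar : Sg -> nat) (f : form Sg) : Prop :=
  match f with
  | fEq _ _ _ | fFalse => True
  | fRel s l => length l = ar s
  | fNot g | fAll g | fEx g => wf ar g
  | fAnd g h | fOr g h | fImp g h => wf ar g /\ wf ar h
  end.

Fixpoint closed_at (Sg : Type) (k : nat) (f : form Sg) : Prop :=
  match f with
  | fEq _ i j => i < k /\ j < k
  | fRel _ l => Forall (fun i => i < k) l
  | fFalse => True
  | fNot g => closed_at k g
  | fAll g | fEx g => closed_at (S k) g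
  | fAnd g h | fOr g h | fImp g h => closed_at k g /\ closed_at k h
  end.

(* A structure: domain, the interpretation of the equality symbol
   (the genuine equality of the objects in the domain), relations. *)
Record structure (Sg : Type) := {
  dom : Type;
  deq : dom -> dom -> Prop;
  drel : Sg -> list dom -> Prop }.

Definition scons (D : Type) (d : D) (rho : nat -> D) : nat -> D :=
  fun i => match i with 0 => d | S i => rho i end.

Fixpoint sat (Sg : Type) (M : structure Sg) (rho : nat -> dom M) (f : form Sg)
  : Prop :=
  match f with
  | fEq _ i j => deq M (rho i) (rho j)
  | fRel s l => drel M s (map rho l)
  | fFalse => False
  | fNot g => ~ sat M rho g
  | fAnd g h => sat M rho g /\ sat M rho h
  | fOr g h => sat M rho g \/ sat M rho h
  | fImp g h => sat M rho g -> sat M rho h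
  | fAll g => forall d, sat M (scons d rho) g
  | fEx g => exists d, sat M (scons d rho) g
  end.

Definition cpair (a b : nat) : nat := (a + b) * (a + b + 1) / 2 + b.

Fixpoint code_list (l : list nat) : nat :=
  match l with [] => 0 | x :: l => S (cpair x (code_list l)) end.

Fixpoint code (Sg : Type) (cs : Sg -> nat) (f : form Sg) : nat :=
  match f with
  | fEq _ i j => cpair 0 (cpair i j)
  | fRel s l => cpair 1 (cpair (cs s) (code_list l))
  | fFalse => cpair 2 0
  | fNot g => cpair 3 (code cs g)
  | fAnd g h => cpair 4 (cpair (code cs g) (code cs h))
  | fOr g h => cpair 5 (cpair (code cs g) (code cs h))
  | fImp g h => cpair 6 (cpair (code cs g) (code cs h))
  | fAll g => cpair 7 (code cs g)
  | fEx g => cpair 8 (code cs g)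
  end.

Definition FO (Sg : Type) (ar : Sg -> nat) (cs : Sg -> nat) (M : structure Sg)
  : nat -> Prop :=
  fun k => exists f : form Sg,
    code cs f = k /\ wf ar f /\ closed_at 0 f /\ forall rho, sat M rho f.

Inductive rf : Type :=
| rZ : rf
| rSucc : rf
| rP : nat -> rf
| rC : rf -> list rf -> rf
| rR : rf -> rf -> rf
| rM : rf -> rf.

Inductive eval : rf -> list nat -> nat -> Prop :=
| ev_Z xs : eval rZ xs 0
| ev_S x xs : eval rSucc (x :: xs) (S x)
| ev_P i xs : i < length xs -> eval (rP i) xs (nth i xs 0)
| ev_C f gs xs ys y : evals gs xs ys -> eval f ys y -> eval (rC f gs) xs y
| ev_R0 f g xs y : eval f xs y -> eval (rR f g) (0 :: xs) y
| ev_RS f g n xs z y : eval (rR f g) (n :: xs) z -> eval g (n :: z :: xs) y ->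
    eval (rR f g) (S n :: xs) y
| ev_M f xs n : eval f (n :: xs) 0 ->
    (forall m, m < n -> exists k, eval f (m :: xs) (S k)) -> eval (rM f) xs n
with evals : list rf -> list nat -> list nat -> Prop :=
| evs_nil xs : evals [] xs []
| evs_cons g gs xs y ys : eval g xs y -> evals gs xs ys ->
    evals (g :: gs) xs (y :: ys).

Definition computable (f : nat -> nat) : Prop :=
  exists c : rf, forall x, eval c [x] (f x).

Definition many_one_le (A B : nat -> Prop) : Prop :=
  exists f, computable f /\ forall x, A x <-> B (f x).

Definition many_one_equiv (A B : nat -> Prop) : Prop :=
  many_one_le A B /\ many_one_le B A.

Open Scope R_scope.
Fixpoint sumFin (n : nat) : (Fin.t n -> R) -> R :=
  match n with
  | O => fun _ => 0
  | S m => fun f => f Fin.F1 + @sumFin m (fun i => f (Fin.FS i))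
  end.

Definition point (n : nat) := Fin.t n -> R.

Definition edist (n : nat) (x y : point n) : R :=
  sqrt (@sumFin n (fun i => (x i - y i) ^ 2)).

Definition is_open (n : nat) (U : point n -> Prop) : Prop :=
  forall x, U x -> exists eps, 0 < eps /\ forall y, edist x y < eps -> U y.

Definition opens (n : nat) := { U : point n -> Prop | is_open U }.
Close Scope R_scope.

Inductive LatSym := LSub.
Definition lat_ar (_ : LatSym) : nat := 2.
Definition lat_code (_ : LatSym) : nat := 0.

Definition lat_rel (n : nat) (s : LatSym) (l : list (opens n)) : Prop :=
  match l with
  | [U; V] => forall x, proj1_sig U x -> proj1_sig V x
  | _ => False
  end.

Definition Sigma01 (n : nat) : structure LatSym := {|
  dom := opens n;
  deq := fun U V => forall x, proj1_sig U x <-> proj1_sig V x;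
  drel := @lat_rel n |}.

Inductive N2Sym := NNat | NSet | NIn | NAdd | NMul.
Definition n2_ar (s : N2Sym) : nat :=
  match s with NNat | NSet => 1 | NIn => 2 | NAdd | NMul => 3 end.
Definition n2_code (s : N2Sym) : nat :=
  match s with NNat => 0 | NSet => 1 | NIn => 2 | NAdd => 3 | NMul => 4 end.

Definition N2dom := (nat + (nat -> Prop))%type.

Definition n2_eq (a b : N2dom) : Prop :=
  match a, b with
  | inl x, inl y => x = y
  | inr X, inr Y => forall k, X k <-> Y k
  | _, _ => False
  end.

Definition n2_rel (s : N2Sym) (l : list N2dom) : Prop :=
  match s, l with
  | NNat, [inl _] => True
  | NSet, [inr _] => True
  | NIn, [inl k; inr X] => X k
  | NAdd, [inl a; inl b; inl c] => (a + b)%nat = c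
  | NMul, [inl a; inl b; inl c] => (a * b)%nat = c
  | _, _ => False
  end.

Definition N2 : structure N2Sym := {|
  dom := N2dom; deq := n2_eq; drel := n2_rel |}.

(* Main.v *)
(** In both directions the reduction is a first-order interpretation, whose
    translation of formulas is compositional and hence recursive on codes.

    Lattice into arithmetic: an open set is coded through its complement, a closed
    set being the closure of a sequence of points and a real the supremum of a set
    of fractions.  Every set of numbers codes some open set, every open set is
    coded, and inclusion becomes an arithmetical statement about approximations.

    Arithmetic into lattice: points are the coatoms.  In the plane of the first two
    coordinates take the grid of points with natural coordinates.  The components of
    the strips [|x_0 - k| < 1/2] and [|x_1 - k| < 1/2] recover the column and the row
    of a grid point, so grid points are pairs of natural numbers; since the grid is
    discrete, open sets code arbitrary subsets of it, that is, arbitrary binary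
    relations on the natural numbers.  Hence the strips and the grid can be
    existentially quantified as parameters satisfying finitely many conditions, among
    them second-order induction, which pin down second-order arithmetic. *)

Require Import Defs.
From Stdlib Require Import Reals List Arith Lia Lra.
From Stdlib Require Import Classical ClassicalEpsilon FunctionalExtensionality PropExtensionality.
From Stdlib Require Vectors.Fin.
Import ListNotations.
Set Implicit Arguments.

(** * Recursive functions on codes *)

(** A many-one reduction acts on every number, so numbers that are no codes, codes of ill-formed
    formulas and codes of open formulas must also be kept away from the true sentences. This is why
    the translation on codes carries an error value through its clauses, and why it is shown to
    reflect well-formedness and closedness rather than only preserve them.

    The lattice formulas do not say that their parameters are the intended grid. It suffices that
    every choice satisfying [good] yields a full copy of second-order arithmetic: discreteness lets
    open sets realise every set of grid points, so the induction axiom, which ranges over open sets,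
    is full induction and leaves no nonstandard numbers. The concrete grid only shows that some
    choice exists.

    Numbers are the diagonal grid points $(k,k)$: each column and each row meets the diagonal once,
    so both projections of a pair land in one copy of the numbers. Connectedness enters through
    quasi-components because a decomposition into disjoint open sets is expressible by inclusion.
    The second dimension provides the direction in which points of a strip can be joined. *)

Definition Rec (k : nat) (F : list nat -> nat) : Prop :=
  exists c, forall xs, length xs = k -> eval c xs (F xs).

Definition computable2 (h : nat -> nat -> nat) : Prop :=
  exists c, forall x y, eval c [x; y] (h x y).

Definition computable3 (h : nat -> nat -> nat -> nat) : Prop :=
  exists c, forall x y z, eval c [x; y; z] (h x y z).

Lemma Rec_ext k F G :
  (forall xs, length xs = k -> F xs = G xs) -> Rec k F -> Rec k G.
Proof.
  intros E [c H]. exists c. intros xs L. rewrite <- E by exact L. auto.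
Qed.

(** Projections serve as variables: with the composition lemmas, a function written as an ordinary
    expression in [nth i xs 0] is shown recursive by proof search. *)
Lemma Rec_nth k i : i < k -> Rec k (fun xs => nth i xs 0).
Proof. intros L. exists (rP i). intros xs E. constructor. lia. Qed.

Lemma Rec_const k c : Rec k (fun _ => c).
Proof.
  induction c as [|c [p H]].
  - exists rZ. intros. constructor.
  - exists (rC rSucc [p]). intros xs L. econstructor.
    + constructor; [apply H, L | constructor].
    + constructor.
Qed.

Lemma Rec_comp1 k h F : computable h -> Rec k F -> Rec k (fun xs => h (F xs)).
Proof.
  intros [c H] [p Hp]. exists (rC c [p]). intros xs L. econstructor.
  - constructor; [apply Hp, L | constructor].
  - apply H.
Qed.

Lemma Rec_comp2 k h F G :
  computable2 h -> Rec k F -> Rec k G -> Rec k (fun xs => h (F xs) (G xs)).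
Proof.
  intros [c H] [p Hp] [q Hq]. exists (rC c [p; q]). intros xs L. econstructor.
  - constructor; [apply Hp, L | constructor; [apply Hq, L | constructor]].
  - apply H.
Qed.

Lemma Rec_comp3 k h F G K :
  computable3 h -> Rec k F -> Rec k G -> Rec k K ->
  Rec k (fun xs => h (F xs) (G xs) (K xs)).
Proof.
  intros [c H] [p Hp] [q Hq] [r Hr]. exists (rC c [p; q; r]). intros xs L.
  econstructor.
  - constructor; [apply Hp, L | constructor; [apply Hq, L |
      constructor; [apply Hr, L | constructor]]].
  - apply H.
Qed.

Lemma Rec_computable h : Rec 1 (fun xs => h (nth 0 xs 0)) -> computable h.
Proof. intros [c H]. exists c. intros x. exact (H [x] eq_refl). Qed.

Lemma Rec_computable2 h :
  Rec 2 (fun xs => h (nth 0 xs 0) (nth 1 xs 0)) -> computable2 h.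
Proof. intros [c H]. exists c. intros x y. exact (H [x; y] eq_refl). Qed.

Lemma Rec_computable3 h :
  Rec 3 (fun xs => h (nth 0 xs 0) (nth 1 xs 0) (nth 2 xs 0)) -> computable3 h.
Proof. intros [c H]. exists c. intros x y z. exact (H [x; y; z] eq_refl). Qed.

Lemma computable_primrec a g :
  computable2 g -> computable (fun n => nat_rect (fun _ => nat) a g n).
Proof.
  intros [c H]. destruct (Rec_const 0 a) as [z Hz].
  exists (rR z c). intros x. induction x as [|x IH]; simpl.
  - constructor. apply Hz. reflexivity.
  - econstructor; [exact IH | apply H].
Qed.

Lemma computable2_primrec f g :
  computable f -> computable3 g ->
  computable2 (fun n y => nat_rect (fun _ => nat) (f y) (fun m z => g m z y) n).
Proof.
  intros [c H] [d K]. exists (rR c d). intros x y.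
  induction x as [|x IH]; simpl.
  - constructor. apply H.
  - econstructor; [exact IH | apply K].
Qed.

Lemma computable_S : computable S.
Proof. exists rSucc. constructor. Qed.

Lemma Rec_S k F : Rec k F -> Rec k (fun xs => S (F xs)).
Proof. apply Rec_comp1, computable_S. Qed.

Create HintDb rec.
#[global] Hint Resolve Rec_const Rec_S : rec.
#[global] Hint Extern 1 (Rec _ (fun xs => nth _ xs 0)) => apply Rec_nth; lia : rec.

Lemma computable2_ext h h' :
  (forall x y, h x y = h' x y) -> computable2 h -> computable2 h'.
Proof. intros E [c H]. exists c. intros. rewrite <- E. apply H. Qed.

Lemma computable_ext h h' : (forall x, h x = h' x) -> computable h -> computable h'.
Proof. intros E [c H]. exists c. intros. rewrite <- E. apply H. Qed.

Lemma computable_id : computable (fun x => x).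
Proof. apply Rec_computable. auto with rec. Qed.

Lemma computable2_add : computable2 Nat.add.
Proof.
  eapply computable2_ext;
    [| apply (@computable2_primrec (fun y => y) (fun _ z _ => S z))].
  - intros x y. induction x; simpl; congruence.
  - apply computable_id.
  - apply Rec_computable3. auto with rec.
Qed.

Lemma Rec_add k F G : Rec k F -> Rec k G -> Rec k (fun xs => F xs + G xs).
Proof. apply Rec_comp2, computable2_add. Qed.
#[global] Hint Resolve Rec_add : rec.

Lemma computable_pred : computable Nat.pred.
Proof.
  eapply computable_ext; [| apply (@computable_primrec 0 (fun n _ => n))].
  - intros []; reflexivity.
  - apply Rec_computable2. auto with rec.
Qed.

Lemma Rec_pred k F : Rec k F -> Rec k (fun xs => Nat.pred (F xs)).
Proof. apply Rec_comp1, computable_pred. Qed.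
#[global] Hint Resolve Rec_pred : rec.

Lemma Rec_sub k F G : Rec k F -> Rec k G -> Rec k (fun xs => F xs - G xs).
Proof.
  intros HF HG.
  (* Primitive recursion runs on the first argument, here the number subtracted. *)
  apply (@Rec_comp2 k (fun y x => x - y) G F); auto.
  eapply computable2_ext;
    [| apply (@computable2_primrec (fun y => y) (fun _ z _ => Nat.pred z))].
  - intros x y. induction x; simpl; lia.
  - apply computable_id.
  - apply Rec_computable3. auto with rec.
Qed.
#[global] Hint Resolve Rec_sub : rec.

Definition ifz (c a b : nat) : nat := match c with 0 => a | S _ => b end.

Lemma Rec_ifz k C F G :
  Rec k C -> Rec k F -> Rec k G -> Rec k (fun xs => ifz (C xs) (F xs) (G xs)).
Proof.
  intros HC HF HG. assert (H : computable3 ifz); [| exact (Rec_comp3 H HC HF HG)].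
  assert (Hc : exists p, forall x y z, eval p [x; y; z] (ifz x y z)).
  (* A recursion that ignores its previous value is a case distinction. In the step the arguments
     are the predecessor, the previous value, [y] and [z], so index 3 is [z]. *)
  { exists (rR (rP 0) (rP 3)). intros x y z. induction x as [|x IH]; simpl.
    - constructor. refine (@ev_P 0 [y; z] _). simpl. lia.
    - econstructor; [exact IH|]. refine (@ev_P 3 [x; ifz x y z; y; z] _). simpl. lia. }
  exact Hc.
Qed.
#[global] Hint Resolve Rec_ifz : rec.

Definition sw (t k a b : nat) : nat := if t =? k then a else b.

Lemma Rec_sw k T K F G :
  Rec k T -> Rec k K -> Rec k F -> Rec k G ->
  Rec k (fun xs => sw (T xs) (K xs) (F xs) (G xs)).
Proof.
  intros HT HK HF HG.
  (* The sum of the two truncated differences vanishes exactly at equality. *)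
  apply Rec_ext with (fun xs => ifz ((T xs - K xs) + (K xs - T xs)) (F xs) (G xs)).
  - intros xs _. unfold sw. destruct (Nat.eqb_spec (T xs) (K xs)) as [E|E].
    + rewrite E, Nat.sub_diag. reflexivity.
    + destruct (T xs - K xs + (K xs - T xs)) eqn:Q; [lia | reflexivity].
  - auto with rec.
Qed.
#[global] Hint Resolve Rec_sw : rec.

Fixpoint tri (n : nat) : nat := match n with 0 => 0 | S m => tri m + S m end.

Lemma Rec_tri k F : Rec k F -> Rec k (fun xs => tri (F xs)).
Proof.
  apply Rec_comp1.
  eapply computable_ext; [| apply (@computable_primrec 0 (fun n z => z + S n))].
  - intros x. induction x; simpl; congruence.
  - apply Rec_computable2. auto with rec.
Qed.
#[global] Hint Resolve Rec_tri : rec.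

(** Triangular numbers replace the division by 2, so that pairing becomes primitive recursive by
    addition alone. *)
Lemma cpair_tri a b : cpair a b = tri (a + b) + b.
Proof.
  unfold cpair. f_equal. generalize (a + b). intros s.
  assert (E : s * (s + 1) = tri s * 2) by (induction s; simpl tri; nia).
  rewrite E. apply Nat.div_mul. lia.
Qed.
#[global] Opaque cpair.
Arguments cpair : simpl never.

Lemma Rec_cpair k F G : Rec k F -> Rec k G -> Rec k (fun xs => cpair (F xs) (G xs)).
Proof.
  intros HF HG. apply Rec_ext with (fun xs => tri (F xs + G xs) + G xs).
  - intros. symmetry. apply cpair_tri.
  - auto with rec.
Qed.
#[global] Hint Resolve Rec_cpair : rec.

(** The largest [s] with [tri s <= n], maintained incrementally. On [cpair a b] it returns [a + b],
    from which both components are recovered. *)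
Fixpoint troot (n : nat) : nat :=
  match n with
  | 0 => 0
  | S m => ifz (tri (S (troot m)) - S m) (S (troot m)) (troot m)
  end.

Definition psnd (n : nat) : nat := n - tri (troot n).
Definition pfst (n : nat) : nat := troot n - psnd n.

Lemma troot_spec n : tri (troot n) <= n < tri (S (troot n)).
Proof.
  induction n as [|n IH]; [simpl; lia|].
  cbn [troot]. destruct (tri (S (troot n)) - S n) eqn:E; cbn [ifz].
  - cbn [tri] in *. lia.
  - lia.
Qed.

Lemma tri_lt s t : s < t -> tri s + s < tri t.
Proof. induction 1; simpl; lia. Qed.

Lemma troot_unique n s : tri s <= n < tri (S s) -> troot n = s.
Proof.
  intros H. pose proof (troot_spec n) as K.
  destruct (Nat.lt_trichotomy (troot n) s) as [L|[L|L]]; auto.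
  - pose proof (tri_lt L). simpl tri in *. lia.
  - pose proof (tri_lt L). simpl tri in *. lia.
Qed.

Lemma psnd_cpair a b : psnd (cpair a b) = b.
Proof.
  unfold psnd. rewrite cpair_tri.
  rewrite (@troot_unique _ (a + b)); [lia|]. simpl. lia.
Qed.

Lemma pfst_cpair a b : pfst (cpair a b) = a.
Proof.
  unfold pfst. rewrite psnd_cpair, cpair_tri.
  rewrite (@troot_unique _ (a + b)); [lia|]. simpl. lia.
Qed.

Lemma cpair_eta n : cpair (pfst n) (psnd n) = n.
Proof.
  rewrite cpair_tri. pose proof (troot_spec n) as H. unfold pfst, psnd in *.
  simpl in H. replace (troot n - (n - tri (troot n)) + (n - tri (troot n)))
    with (troot n) by lia. lia.
Qed.

Lemma cpair_inj a b c d : cpair a b = cpair c d -> a = c /\ b = d.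
Proof.
  intros E. split.
  - rewrite <- (pfst_cpair a b), E. apply pfst_cpair.
  - rewrite <- (psnd_cpair a b), E. apply psnd_cpair.
Qed.

Lemma cpair_ge_r a b : b <= cpair a b.
Proof. rewrite cpair_tri. lia. Qed.

Lemma cpair_ge_l a b : a <= cpair a b.
Proof.
  rewrite cpair_tri. enough (a + b <= tri (a + b)) by lia.
  generalize (a + b). intros s. induction s; simpl; lia.
Qed.

(** Recursion on codes descends by this inequality. It fails for tag 0, as [cpair 0 0] is 0, but
    that tag belongs to equations, which have no subformulas. *)
Lemma cpair_gt_r a b : 0 < a -> b < cpair a b.
Proof. rewrite cpair_tri. destruct a; simpl; lia. Qed.

Lemma computable_troot : computable troot.
Proof.
  eapply computable_ext;
    [| apply (@computable_primrec 0 (fun n z => ifz (tri (S z) - S n) (S z) z))].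
  - intros x. induction x as [|x IH]; [reflexivity|].
    cbn [troot nat_rect]. rewrite IH. reflexivity.
  - apply Rec_computable2. auto 10 with rec.
Qed.

Lemma Rec_psnd k F : Rec k F -> Rec k (fun xs => psnd (F xs)).
Proof.
  intros H. unfold psnd. pose proof (Rec_comp1 computable_troot H). auto with rec.
Qed.
#[global] Hint Resolve Rec_psnd : rec.

Lemma Rec_pfst k F : Rec k F -> Rec k (fun xs => pfst (F xs)).
Proof.
  intros H. unfold pfst. pose proof (Rec_comp1 computable_troot H). auto with rec.
Qed.
#[global] Hint Resolve Rec_pfst : rec.

(** * Course-of-values recursion *)

Section CourseOfValues.
Variable Phi : nat -> nat -> nat.

Fixpoint history (n : nat) : nat :=
  match n with 0 => 0 | S m => cpair (Phi m (history m)) (history m) end.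

Definition cov (n : nat) : nat := Phi n (history n).

Definition lookup (n t m : nat) : nat := pfst (Nat.iter (Nat.pred n - m) psnd t).

Lemma lookup_history n m : m < n -> lookup n (history n) m = cov m.
Proof.
  unfold lookup. intros L.
  (* The newest value is outermost, so [d] second projections lead from stage [S m + d] back to
     stage [S m], whose first component is the value at [m]. *)
  assert (E : forall d, Nat.iter d psnd (history (S m + d)) = history (S m)).
  { intros d. induction d as [|d IH]; [rewrite Nat.add_0_r; reflexivity|].
    rewrite Nat.iter_succ_r. rewrite Nat.add_succ_r.
    cbn [history]. rewrite psnd_cpair. exact IH. }
  specialize (E (Nat.pred n - m)).
  replace (S m + (Nat.pred n - m)) with n in E by lia.
  rewrite E. cbn [history]. apply pfst_cpair.
Qed.

Lemma computable_cov : computable2 Phi -> computable cov.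
Proof.
  intros H.
  assert (Hh : computable history).
  { eapply computable_ext;
      [| apply (@computable_primrec 0 (fun n z => cpair (Phi n z) z))].
    - intros x. induction x as [|x IH]; [reflexivity|].
      cbn [nat_rect history]. rewrite IH. reflexivity.
    - apply Rec_computable2. apply Rec_cpair; [apply Rec_comp2|]; auto with rec. }
  apply Rec_computable. unfold cov. apply Rec_comp2; auto with rec.
  apply Rec_comp1; auto with rec.
Qed.
End CourseOfValues.

Lemma Rec_lookup k N T F :
  Rec k N -> Rec k T -> Rec k F -> Rec k (fun xs => lookup (N xs) (T xs) (F xs)).
Proof.
  intros HN HT HF. unfold lookup. apply Rec_pfst.
  apply (@Rec_comp2 k (fun d t => Nat.iter d psnd t)); auto with rec.
  eapply computable2_ext;
    [| apply (@computable2_primrec (fun y => y) (fun _ z _ => psnd z))].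
  - intros x y. induction x; simpl; congruence.
  - apply computable_id.
  - apply Rec_computable3. auto with rec.
Qed.
#[global] Hint Resolve Rec_lookup : rec.

(** * Interpretations give many-one reductions *)

Definition prepend (D : Type) (l : list D) (rho : nat -> D) : nat -> D :=
  fold_right (@scons D) rho l.

Lemma prepend_nth (D : Type) (l : list D) rho i d :
  i < length l -> prepend l rho i = nth i l d.
Proof.
  revert i. induction l as [|a l IH]; simpl; intros i L; [lia|].
  destruct i; simpl; [reflexivity|]. apply IH. lia.
Qed.

Lemma prepend_add (D : Type) (l : list D) rho j : prepend l rho (length l + j) = rho j.
Proof. induction l as [|a l IH]; simpl; auto. Qed.

Lemma prepend_app (D : Type) (l l' : list D) rho :
  prepend (l ++ l') rho = prepend l (prepend l' rho).
Proof. apply fold_right_app. Qed.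

(** * Unique readability of codes, and dependence on free variables only *)

Section Codes.
Variables (Sg : Type) (cs : Sg -> nat).
Hypothesis cs_inj : forall s t, cs s = cs t -> s = t.

Lemma code_list_inj l l' : code_list l = code_list l' -> l = l'.
Proof.
  revert l'. induction l as [|a l IH]; intros [|b l']; cbn; intros E; try discriminate.
  - reflexivity.
  - injection E as E. apply cpair_inj in E as [-> E]. f_equal. auto.
Qed.

Lemma code_inj f g : code cs f = code cs g -> f = g.
Proof.
  revert g. induction f; intros []; cbn [code]; intros E;
    apply cpair_inj in E as [E1 E2]; try discriminate.
  all: try (apply cpair_inj in E2 as [E2 E3]).
  all: try (f_equal; auto; fail).
  - apply cs_inj in E2 as ->. apply code_list_inj in E3 as ->. reflexivity.
Qed.

(* The tag 9 is not used by [code]: [junk] stands for the translation of a number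
   that is no code, and every number built from it by the tags is no code either. *)
Definition junk : nat := cpair 9 0.

Lemma code_junk f : code cs f <> junk.
Proof.
  unfold junk. destruct f; cbn [code]; intros E;
    apply cpair_inj in E as [E1 E2]; discriminate.
Qed.

Lemma code_ex_inv f x : code cs f = cpair 8 x -> exists g, f = fEx g /\ code cs g = x.
Proof.
  destruct f; cbn [code]; intros E; apply cpair_inj in E as [E1 E2];
    try discriminate. eauto.
Qed.

Lemma code_and_inv f x y : code cs f = cpair 4 (cpair x y) ->
  exists g h, f = fAnd g h /\ code cs g = x /\ code cs h = y.
Proof.
  destruct f; cbn [code]; intros E; apply cpair_inj in E as [E1 E2];
    try discriminate. apply cpair_inj in E2 as [E2 E3]. eauto.
Qed.

Lemma sat_ext (M : structure Sg) k (f : form Sg) :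
  closed_at k f -> forall rho rho', (forall i, i < k -> rho i = rho' i) ->
  (sat M rho f <-> sat M rho' f).
Proof.
  revert k. induction f; cbn [closed_at sat]; intros k C rho rho' E.
  - destruct C. rewrite !E by assumption. tauto.
  - assert (Q : map rho l = map rho' l);
      [| rewrite Q; tauto].
    apply map_ext_in. intros i I. apply E. revert i I. apply Forall_forall, C.
  - tauto.
  - specialize (IHf k C _ _ E). tauto.
  - destruct C. specialize (IHf1 k H _ _ E). specialize (IHf2 k H0 _ _ E). tauto.
  - destruct C. specialize (IHf1 k H _ _ E). specialize (IHf2 k H0 _ _ E). tauto.
  - destruct C. specialize (IHf1 k H _ _ E). specialize (IHf2 k H0 _ _ E). tauto.
  - assert (Q : forall d, sat M (scons d rho) f <-> sat M (scons d rho') f).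
    { intros d. apply (IHf (S k) C). intros [|i] L; simpl; auto. apply E. lia. }
    firstorder.
  - assert (Q : forall d, sat M (scons d rho) f <-> sat M (scons d rho') f).
    { intros d. apply (IHf (S k) C). intros [|i] L; simpl; auto. apply E. lia. }
    firstorder.
Qed.

Lemma closed_at_mono k k' (f : form Sg) : k <= k' -> closed_at k f -> closed_at k' f.
Proof.
  revert k k'. induction f; cbn [closed_at]; intros k k' L; try tauto.
  - lia.
  - apply Forall_impl. lia.
  - eauto.
  - intros []; eauto.
  - intros []; eauto.
  - intros []; eauto.
  - apply IHf. lia.
  - apply IHf. lia.
Qed.
End Codes.

Definition exs (Sg : Type) (k : nat) (f : form Sg) : form Sg := Nat.iter k (@fEx Sg) f.
Definition alls (Sg : Type) (k : nat) (f : form Sg) : form Sg := Nat.iter k (@fAll Sg) f.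
Definition tag_iter (t k c : nat) : nat := Nat.iter k (cpair t) c.

Section Blocks.
Variables (Sg : Type) (cs ar : Sg -> nat) (M : structure Sg).

Lemma sat_exs k f rho :
  sat M rho (exs k f) <-> exists l, length l = k /\ sat M (prepend l rho) f.
Proof.
  revert rho. induction k as [|k IH]; intros rho.
  - simpl. split.
    + intros H. exists []. auto.
    + intros [[|] [E H]]; [exact H | discriminate].
  - change (sat M rho (exs (S k) f)) with (exists d, sat M (scons d rho) (exs k f)).
    split.
    + intros [d H]. apply IH in H as [l [E H]]. exists (l ++ [d]).
      rewrite length_app, prepend_app. simpl. split; [lia | exact H].
    (* Inner quantifiers push their witnesses to the front, so the witness of the outermost one is
       the last entry of the block. *)
    + intros [l [E H]]. destruct (exists_last (l := l)) as [l' [d ->]].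
      { intros ->. discriminate. }
      exists d. apply IH. exists l'. rewrite length_app in E. simpl in E.
      rewrite prepend_app in H. split; [lia | exact H].
Qed.

Lemma sat_alls k f rho :
  sat M rho (alls k f) <-> forall l, length l = k -> sat M (prepend l rho) f.
Proof.
  revert rho. induction k as [|k IH]; intros rho.
  - simpl. split.
    + intros H [|]; [auto | discriminate].
    + intros H. exact (H [] eq_refl).
  - change (sat M rho (alls (S k) f)) with (forall d, sat M (scons d rho) (alls k f)).
    split.
    + intros H l E. destruct (exists_last (l := l)) as [l' [d ->]].
      { intros ->. discriminate. }
      specialize (H d). rewrite IH in H. rewrite prepend_app. apply H.
      rewrite length_app in E. simpl in E. lia.
    + intros H d. apply IH. intros l E. specialize (H (l ++ [d])).
      rewrite length_app, prepend_app in H. apply H. simpl. lia.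
Qed.

Lemma wf_exs k f : wf ar (exs k f) <-> wf ar f.
Proof. induction k; simpl in *; tauto. Qed.
Lemma wf_alls k f : wf ar (alls k f) <-> wf ar f.
Proof. induction k; simpl in *; tauto. Qed.
Lemma closed_exs j k (f : form Sg) : closed_at j (exs k f) <-> closed_at (k + j) f.
Proof.
  revert j. induction k as [|k IH]; intros j; simpl; [tauto|].
  rewrite IH. rewrite Nat.add_succ_r. tauto.
Qed.
Lemma closed_alls j k (f : form Sg) : closed_at j (alls k f) <-> closed_at (k + j) f.
Proof.
  revert j. induction k as [|k IH]; intros j; simpl; [tauto|].
  rewrite IH. rewrite Nat.add_succ_r. tauto.
Qed.
Lemma code_exs k f : code cs (exs k f) = tag_iter 8 k (code cs f).
Proof. induction k as [|k IH]; cbn; [reflexivity|]. f_equal. exact IH. Qed.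
Lemma code_alls k f : code cs (alls k f) = tag_iter 7 k (code cs f).
Proof. induction k as [|k IH]; cbn; [reflexivity|]. f_equal. exact IH. Qed.
End Blocks.

(* A first-order interpretation of [M] in [M'] with [m] parameters.  The
   translation of a formula is compositional on codes: each quantifier binds the
   translated variable together with fresh copies of the parameters, so the
   parameters always have the indices [0 .. m-1] and the old variable [i] has the
   index [S m * i + m], independently of the depth. *)
Section Interpretation.
Variables (Sg Sg' : Type) (ar cs : Sg -> nat) (ar' cs' : Sg' -> nat).
Variables (M : structure Sg) (M' : structure Sg').
Hypothesis cs_inj : forall s t, cs s = cs t -> s = t.
Hypothesis cs_inj' : forall s t, cs' s = cs' t -> s = t.
Variable syms : list Sg.
Hypothesis syms_all : forall s, In s syms.
Variables (m : nat) (Ax sig_eq : form Sg') (sig : Sg -> form Sg').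
Hypothesis Ax_wf : wf ar' Ax.
Hypothesis Ax_closed : closed_at m Ax.
Hypothesis sig_eq_wf : wf ar' sig_eq.
Hypothesis sig_eq_closed : closed_at (2 + m) sig_eq.
Hypothesis sig_wf : forall s, wf ar' (sig s).
Hypothesis sig_closed : forall s, closed_at (ar s + m) (sig s).
Hypothesis deq_eq : forall a b, deq M' a b <-> a = b.

Definition agree (p rho : nat -> dom M') := forall t, t < m -> rho t = p t.

(** [rep p y x] is to be read as: under the parameters [p], the element [y] represents [x]. It is a
    relation total on both sides; an element may have many representatives, and [sig_eq] identifies
    them. *)
Variable rep : (nat -> dom M') -> dom M' -> dom M -> Prop.
Hypothesis Ax_sat : exists p, sat M' p Ax.
Hypothesis rep_total : forall p, sat M' p Ax -> forall y, exists x, rep p y x.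
Hypothesis rep_onto : forall p, sat M' p Ax -> forall x, exists y, rep p y x.
Hypothesis rep_eq : forall p, sat M' p Ax -> forall rho, agree p rho ->
  forall y0 y1 x0 x1, rep p y0 x0 -> rep p y1 x1 ->
  (sat M' (prepend [y1; y0] rho) sig_eq <-> deq M x0 x1).
Hypothesis rep_rel : forall p, sat M' p Ax -> forall rho, agree p rho ->
  forall s ys xs, length ys = ar s -> Forall2 (rep p) ys xs ->
  (sat M' (prepend (rev ys) rho) (sig s) <-> drel M s xs).

Definition vi (i : nat) : nat := S m * i + m.

(** Arguments are passed by quantifying copies of them instead of by substitution, so on codes [f]
    stays a constant and nothing has to be renamed. [d] counts the copies already opened. The copies
    end up in reverse order, followed directly by the parameters. *)
Fixpoint bind (l : list nat) (d : nat) (f : form Sg') : form Sg' :=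
  match l with
  | [] => f
  | i :: l => fEx (fAnd (fEq _ 0 (vi i + S d)) (bind l (S d) f))
  end.

Fixpoint same_params (t : nat) : form Sg' :=
  match t with
  | 0 => fNot fFalse
  | S t => fAnd (fEq _ t (S m + t)) (same_params t)
  end.

Fixpoint tr (f : form Sg) : form Sg' :=
  match f with
  | fEq _ i j => bind [i; j] 0 sig_eq
  | fRel s l => bind l 0 (sig s)
  | fFalse => fFalse
  | fNot g => fNot (tr g)
  | fAnd g h => fAnd (tr g) (tr h)
  | fOr g h => fOr (tr g) (tr h)
  | fImp g h => fImp (tr g) (tr h)
  | fAll g => alls (S m) (fImp (same_params m) (tr g))
  | fEx g => exs (S m) (fAnd (same_params m) (tr g))
  end.

Lemma sat_bind l d f rho :
  sat M' rho (bind l d f) <->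
  sat M' (prepend (rev (map (fun i => rho (vi i + d)) l)) rho) f.
Proof.
  revert d rho. induction l as [|i l IH]; intros d rho; [simpl; tauto|].
  cbn [bind map rev]. cbn [sat]. split.
  - intros [x [E H]]. apply deq_eq in E. rewrite Nat.add_succ_r in E.
    change (x = rho (vi i + d)) in E. apply IH in H.
    rewrite prepend_app. cbn [prepend fold_right].
    rewrite <- E. erewrite map_ext; [exact H|]. intros j. cbv beta.
    rewrite Nat.add_succ_r. reflexivity.
  - intros H. exists (rho (vi i + d)). split.
    + apply deq_eq. rewrite Nat.add_succ_r. reflexivity.
    + apply IH. rewrite prepend_app in H. cbn [prepend fold_right] in H.
      erewrite map_ext; [exact H|]. intros j.
      rewrite Nat.add_succ_r. reflexivity.
Qed.

Lemma wf_bind l d f : wf ar' f -> wf ar' (bind l d f).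
Proof. revert d. induction l; simpl; auto. Qed.

Lemma closed_bind l d f K : closed_at (length l + m) f -> m <= K ->
  (closed_at (K + d) (bind l d f) <-> Forall (fun i => vi i < K) l).
Proof.
  (* Each copy moves one variable from the list to the context; the bound [r] absorbs it in the
     induction. *)
  assert (G : forall r, closed_at (length l + r) f -> r <= K + d ->
    (closed_at (K + d) (bind l d f) <-> Forall (fun i => vi i < K) l)).
  { revert d. induction l as [|i l IH]; intros d r C L; simpl.
    - split; auto. intros _. eapply closed_at_mono; [|exact C]. simpl. lia.
    - replace (S (K + d)) with (K + S d) by lia. rewrite (IH _ (S r)).
      + rewrite Forall_cons_iff. intuition lia.
      + simpl in C. rewrite Nat.add_succ_r. exact C.
      + lia. }
  intros C L. apply (G m); auto. lia.
Qed.

Lemma same_params_sat t rho :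
  sat M' rho (same_params t) <-> forall i, i < t -> rho i = rho (S m + i).
Proof.
  induction t as [|t IH]; cbn [same_params sat].
  - intuition lia.
  - rewrite IH, deq_eq. split.
    + intros [E H] i L. destruct (Nat.eq_dec i t) as [->|]; auto. apply H. lia.
    + intros H. split; auto.
Qed.

Lemma same_params_wf t : wf ar' (same_params t).
Proof. induction t; simpl; auto. Qed.

Lemma same_params_closed t : closed_at (S m + t) (same_params t).
Proof.
  induction t as [|t IH]; simpl; auto. repeat split; try lia.
  eapply closed_at_mono; [|exact IH]. lia.
Qed.

Lemma tr_wf f : wf ar' (tr f).
Proof.
  induction f; cbn [tr]; try (simpl; auto; fail); try (apply wf_bind; auto).
  - apply wf_alls. simpl. split; auto. apply same_params_wf.
  - apply wf_exs. simpl. split; auto. apply same_params_wf.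
Qed.

Lemma vi_lt i k : vi i < S m * k + m <-> i < k.
Proof. unfold vi. nia. Qed.

(** The equivalence, and not just one implication, is what prevents an open formula from being
    translated into a sentence. *)
Lemma tr_closed f k : wf ar f -> (closed_at (S m * k + m) (tr f) <-> closed_at k f).
Proof.
  revert k. induction f; cbn [tr wf]; intros k W.
  - rewrite <- (Nat.add_0_r (S m * k + m)). rewrite closed_bind; auto; try lia.
    rewrite !Forall_cons_iff, Forall_nil_iff, !vi_lt. simpl. tauto.
  - rewrite <- (Nat.add_0_r (S m * k + m)). rewrite closed_bind; try lia.
    + simpl. rewrite !Forall_forall.
      split; intros H i I; specialize (H i I); now apply vi_lt.
    + rewrite W. auto.
  - simpl. tauto.
  - simpl. apply IHf, W.
  - destruct W as [W1 W2]. cbn [closed_at]. rewrite IHf1, IHf2 by assumption. tauto.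
  - destruct W as [W1 W2]. cbn [closed_at]. rewrite IHf1, IHf2 by assumption. tauto.
  - destruct W as [W1 W2]. cbn [closed_at]. rewrite IHf1, IHf2 by assumption. tauto.
  - rewrite closed_alls. cbn [closed_at].
    replace (S m + (S m * k + m)) with (S m * S k + m) by lia.
    rewrite IHf by assumption. split; [tauto|]. split; auto.
    eapply closed_at_mono; [|apply same_params_closed]. nia.
  - rewrite closed_exs. cbn [closed_at].
    replace (S m + (S m * k + m)) with (S m * S k + m) by lia.
    rewrite IHf by assumption. split; [tauto|]. split; auto.
    eapply closed_at_mono; [|apply same_params_closed]. nia.
Qed.

Lemma vi_S i : vi (S i) = S m + vi i.
Proof. unfold vi. lia. Qed.

Lemma block_env p rho rho' l x :
  sat M' p Ax -> agree p rho' -> (forall i, rep p (rho' (vi i)) (rho i)) ->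
  length l = S m -> rep p (prepend l rho' m) x ->
  (forall i, i < m -> prepend l rho' i = prepend l rho' (S m + i)) ->
  agree p (prepend l rho') /\
  forall i, rep p (prepend l rho' (vi i)) (scons x rho i).
Proof.
  intros A G R L X S. split.
  - intros t T. rewrite S by assumption. rewrite <- L, prepend_add. apply G, T.
  - intros [|i].
    + unfold vi. rewrite Nat.mul_0_r. exact X.
    + rewrite vi_S, <- L, prepend_add. apply R.
Qed.

Lemma block_exists p rho' y : agree p rho' ->
  exists l, length l = S m /\ prepend l rho' m = y /\
    forall i, i < m -> prepend l rho' i = prepend l rho' (S m + i).
Proof.
  intros G. set (l := map p (seq 0 m)).
  assert (L : length l = m) by (unfold l; rewrite length_map, length_seq; lia).
  assert (L' : length (l ++ [y]) = S m) by (rewrite length_app, L; simpl; lia).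
  exists (l ++ [y]). split; [exact L'|]. split.
  - rewrite prepend_app. rewrite <- L at 1. rewrite <- (Nat.add_0_r (length l)).
    apply prepend_add.
  - intros i I. rewrite <- L' at 1. rewrite prepend_add.
    rewrite (prepend_nth _ _ (p 0)) by lia. rewrite app_nth1 by lia.
    unfold l. rewrite map_nth, seq_nth by lia. symmetry. apply G, I.
Qed.

(** At a quantifier, a block of [S m] elements copies the parameters and adds one new element.
    [rep_onto] turns an element of [M] into such a block, [rep_total] reads an element of [M] off a
    given block. *)
Lemma tr_sat f : wf ar f -> forall p, sat M' p Ax -> forall rho rho',
  agree p rho' -> (forall i, rep p (rho' (vi i)) (rho i)) ->
  (sat M' rho' (tr f) <-> sat M rho f).
Proof.
  induction f; cbn [tr wf]; intros W p A rho rho' G R.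
  - rewrite sat_bind. cbn [map rev app]. rewrite !Nat.add_0_r.
    apply rep_eq with p; auto.
  - rewrite sat_bind. apply rep_rel with p; auto.
    + rewrite length_map. exact W.
    + clear W. induction l; simpl; constructor; auto.
      rewrite Nat.add_0_r. auto.
  - simpl. tauto.
  - cbn [sat]. rewrite (IHf W p A rho rho' G R). tauto.
  - cbn [sat]. destruct W as [W1 W2].
    rewrite (IHf1 W1 p A rho rho' G R), (IHf2 W2 p A rho rho' G R). tauto.
  - cbn [sat]. destruct W as [W1 W2].
    rewrite (IHf1 W1 p A rho rho' G R), (IHf2 W2 p A rho rho' G R). tauto.
  - cbn [sat]. destruct W as [W1 W2].
    rewrite (IHf1 W1 p A rho rho' G R), (IHf2 W2 p A rho rho' G R). tauto.
  - rewrite sat_alls. cbn [sat]. split.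
    + intros H x. destruct (rep_onto _ A x) as [y Y].
      destruct (block_exists y G) as [l [Ll [Xl Sl]]]. rewrite <- Xl in Y.
      destruct (@block_env p rho rho' l _ A G R Ll Y Sl) as [G' R'].
      apply (IHf W p A _ _ G' R'). apply H; auto. apply same_params_sat, Sl.
    + intros H l Ll Sl. rewrite same_params_sat in Sl.
      destruct (rep_total _ A (prepend l rho' m)) as [x Xl].
      destruct (@block_env p rho rho' l _ A G R Ll Xl Sl) as [G' R'].
      apply (IHf W p A _ _ G' R'), H.
  - rewrite sat_exs. cbn [sat]. split.
    + intros [l [Ll [Sl H]]]. rewrite same_params_sat in Sl.
      destruct (rep_total _ A (prepend l rho' m)) as [x Xl].
      destruct (@block_env p rho rho' l _ A G R Ll Xl Sl) as [G' R'].
      exists x. apply (IHf W p A _ _ G' R'), H.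
    + intros [x H]. destruct (rep_onto _ A x) as [y Y].
      destruct (block_exists y G) as [l [Ll [Xl Sl]]]. rewrite <- Xl in Y.
      destruct (@block_env p rho rho' l _ A G R Ll Y Sl) as [G' R'].
      exists l. split; auto. split; [apply same_params_sat, Sl|].
      apply (IHf W p A _ _ G' R'), H.
Qed.

(** Existential parameters suffice: by [tr_sat], all choices satisfying [Ax] give the translation of
    a sentence the same truth value. *)
Definition reduct (f : form Sg) : form Sg' := exs m (fAnd Ax (tr f)).

Lemma reduct_true f : wf ar f -> closed_at 0 f ->
  ((forall rho, sat M' rho (reduct f)) <-> (forall rho, sat M rho f)).
Proof.
  intros W C.
  assert (T : forall p, sat M' p Ax -> sat M' p (tr f) -> forall rho, sat M rho f).
  { intros p A H rho.
    destruct (choice (fun i x => rep p (p (vi i)) x)) as [r R].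
    { intros i. apply rep_total, A. }
    apply (sat_ext M f C r); [lia|].
    apply (@tr_sat f W p A r p); auto. intros t _. reflexivity. }
  split.
  - intros H rho. destruct Ax_sat as [p0 _].
    specialize (H p0). apply sat_exs in H as [l [L [A H]]].
    exact (T _ A H rho).
  - intros H rho. apply sat_exs. destruct Ax_sat as [p A].
    exists (map p (seq 0 m)).
    split; [rewrite length_map; apply length_seq|].
    set (q := prepend (map p (seq 0 m)) rho).
    assert (Q : forall i, i < m -> p i = q i).
    { intros i I. unfold q. rewrite (prepend_nth _ _ (p 0))
        by (rewrite length_map, length_seq; lia).
      rewrite map_nth, seq_nth by lia. reflexivity. }
    assert (A' : sat M' q Ax) by (apply (sat_ext M' Ax Ax_closed _ _ Q), A).
    split; [exact A'|].
    destruct (choice (fun i x => rep q (q (vi i)) x)) as [r R].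
    { intros i. apply rep_total, A'. }
    apply (@tr_sat f W q A' r q); auto. intros t _. reflexivity.
Qed.

Lemma reduct_closed f : wf ar f -> (closed_at 0 (reduct f) <-> closed_at 0 f).
Proof.
  intros W. unfold reduct. rewrite closed_exs. cbn [closed_at].
  rewrite <- (tr_closed f 0 W). rewrite Nat.mul_0_r, Nat.add_0_r. simpl. tauto.
Qed.

Lemma reduct_wf f : wf ar' (reduct f).
Proof. apply wf_exs. simpl. split; auto. apply tr_wf. Qed.

(** Recursion on the expected arity [r] checks the length of the coded list on the way: a list too
    short or too long yields [junk]. This check is needed because [tr] itself would turn an atom of
    wrong arity into a well-formed formula. *)
Fixpoint bind_code (r d c lc : nat) : nat :=
  match r with
  | 0 => sw lc 0 c junk
  | S r => sw lc 0 junk (cpair 8 (cpair 4 (cpair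
             (cpair 0 (cpair 0 (vi (pfst (Nat.pred lc)) + S d)))
             (bind_code r (S d) c (psnd (Nat.pred lc))))))
  end.

Lemma bind_code_spec l d f :
  bind_code (length l) d (code cs' f) (code_list l) = code cs' (bind l d f).
Proof.
  revert d. induction l as [|i l IH]; intros d; [reflexivity|].
  cbn [length bind_code code_list bind code]. unfold sw. cbn [Nat.eqb Nat.pred].
  rewrite pfst_cpair, psnd_cpair, IH. reflexivity.
Qed.

Lemma bind_code_cases r d c lc :
  (exists l, length l = r /\ code_list l = lc) \/
  (forall g, code cs' g <> bind_code r d c lc).
Proof.
  revert d lc. induction r as [|r IH]; intros d lc; cbn [bind_code]; unfold sw;
    destruct (Nat.eqb_spec lc 0) as [->|N].
  - left. exists []. auto.
  - right. intros g. apply code_junk.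
  - right. intros g. apply code_junk.
  - destruct (IH (S d) (psnd (Nat.pred lc))) as [[l [L E]]|H].
    + left. exists (pfst (Nat.pred lc) :: l). simpl. split; [lia|].
      rewrite E, cpair_eta. lia.
    + right. intros g E. apply code_ex_inv in E as [g1 [-> E]].
      apply code_and_inv in E as [g2 [g3 [-> [_ E]]]]. exact (H _ E).
Qed.

Definition rel_code (a : nat) : nat :=
  fold_right (fun s acc => sw (pfst a) (cs s)
    (bind_code (ar s) 0 (code cs' (sig s)) (psnd a)) acc) junk syms.

Lemma rel_code_spec s lc :
  rel_code (cpair (cs s) lc) = bind_code (ar s) 0 (code cs' (sig s)) lc.
Proof.
  unfold rel_code. rewrite pfst_cpair, psnd_cpair.
  generalize (syms_all s). generalize syms as l.
  induction l as [|t l IH]; simpl; intros I; [easy|].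
  unfold sw at 1. destruct (Nat.eqb_spec (cs s) (cs t)) as [E|N].
  - apply cs_inj in E as ->. reflexivity.
  - apply IH. destruct I as [->|I]; [easy | exact I].
Qed.

Lemma rel_code_cases a : (exists s, pfst a = cs s) \/ rel_code a = junk.
Proof.
  unfold rel_code. generalize syms as l. induction l as [|t l IH]; simpl; auto.
  unfold sw at 1. destruct (Nat.eqb_spec (pfst a) (cs t)) as [E|N]; eauto.
Qed.

Definition step (n h : nat) : nat :=
  let t := pfst n in
  let a := psnd n in
  let rec x := lookup n h x in
  sw t 0 (bind_code 2 0 (code cs' sig_eq) (code_list [pfst a; psnd a]))
 (sw t 1 (rel_code a)
 (sw t 2 (sw a 0 (cpair 2 0) junk)
 (sw t 3 (cpair 3 (rec a))
 (sw t 4 (cpair 4 (cpair (rec (pfst a)) (rec (psnd a))))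
 (sw t 5 (cpair 5 (cpair (rec (pfst a)) (rec (psnd a))))
 (sw t 6 (cpair 6 (cpair (rec (pfst a)) (rec (psnd a))))
 (sw t 7 (tag_iter 7 (S m) (cpair 6 (cpair (code cs' (same_params m)) (rec a))))
 (sw t 8 (tag_iter 8 (S m) (cpair 4 (cpair (code cs' (same_params m)) (rec a))))
  junk)))))))).

Definition tr_code : nat -> nat := cov step.

Lemma Rec_tag_iter k t r F : Rec k F -> Rec k (fun xs => tag_iter t r (F xs)).
Proof. intros H. induction r as [|r IH]; cbn; auto with rec. Qed.
Hint Resolve Rec_tag_iter : rec.

Lemma Rec_vi k F : Rec k F -> Rec k (fun xs => vi (F xs)).
Proof.
  intros H. unfold vi. apply Rec_add; auto with rec.
  induction (S m) as [|r IH]; cbn; auto with rec.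
Qed.
Hint Resolve Rec_vi : rec.

Lemma Rec_bind_code k r d c F : Rec k F -> Rec k (fun xs => bind_code r d c (F xs)).
Proof.
  revert d F. induction r as [|r IH]; intros d F H; cbn [bind_code]; auto with rec.
  specialize (IH (S d) (fun xs => psnd (Nat.pred (F xs)))). auto 12 with rec.
Qed.
Hint Resolve Rec_bind_code : rec.

Lemma Rec_rel_code k F : Rec k F -> Rec k (fun xs => rel_code (F xs)).
Proof.
  intros H. unfold rel_code. generalize syms as l.
  induction l as [|s l IH]; cbn [fold_right]; auto with rec.
Qed.
Hint Resolve Rec_rel_code : rec.

Lemma computable_tr_code : computable tr_code.
Proof.
  apply computable_cov, Rec_computable2. unfold step. cbn [code_list].
  repeat (apply Rec_sw; [auto with rec | auto with rec | auto 12 with rec |]).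
  auto with rec.
Qed.

Lemma tr_code_eq t a : tr_code (cpair t a) =
  sw t 0 (bind_code 2 0 (code cs' sig_eq) (code_list [pfst a; psnd a]))
 (sw t 1 (rel_code a)
 (sw t 2 (sw a 0 (cpair 2 0) junk)
 (sw t 3 (cpair 3 (tr_code a))
 (sw t 4 (cpair 4 (cpair (tr_code (pfst a)) (tr_code (psnd a))))
 (sw t 5 (cpair 5 (cpair (tr_code (pfst a)) (tr_code (psnd a))))
 (sw t 6 (cpair 6 (cpair (tr_code (pfst a)) (tr_code (psnd a))))
 (sw t 7 (tag_iter 7 (S m) (cpair 6 (cpair (code cs' (same_params m)) (tr_code a))))
 (sw t 8 (tag_iter 8 (S m) (cpair 4 (cpair (code cs' (same_params m)) (tr_code a))))
  junk)))))))).
Proof.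
  unfold tr_code at 1. unfold cov, step. rewrite pfst_cpair, psnd_cpair.
  (* For tag 0 the argument need not be smaller than the code, but the selected clause looks nothing
     up. *)
  destruct (Nat.eq_dec t 0) as [->|N]; [reflexivity|].
  assert (L : a < cpair t a) by (apply cpair_gt_r; lia).
  pose proof (cpair_ge_l (pfst a) (psnd a)) as L1.
  pose proof (cpair_ge_r (pfst a) (psnd a)) as L2.
  rewrite cpair_eta in L1, L2.
  rewrite !lookup_history by lia. reflexivity.
Qed.

Lemma tr_code_spec f : wf ar f -> tr_code (code cs f) = code cs' (tr f).
Proof.
  induction f; cbn [wf code tr]; intros W; rewrite tr_code_eq; unfold sw;
    cbn [Nat.eqb].
  - rewrite pfst_cpair, psnd_cpair. apply (bind_code_spec [n; n0]).
  - rewrite rel_code_spec, <- W. apply bind_code_spec.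
  - reflexivity.
  - rewrite IHf by assumption. reflexivity.
  - rewrite pfst_cpair, psnd_cpair, IHf1, IHf2 by tauto. reflexivity.
  - rewrite pfst_cpair, psnd_cpair, IHf1, IHf2 by tauto. reflexivity.
  - rewrite pfst_cpair, psnd_cpair, IHf1, IHf2 by tauto. reflexivity.
  - rewrite IHf, code_alls by assumption. reflexivity.
  - rewrite IHf, code_exs by assumption. reflexivity.
Qed.

Lemma tag_iter_inv t r c f : code cs' f = tag_iter t r c -> t = 7 \/ t = 8 ->
  exists g, code cs' g = c.
Proof.
  intros E T. revert f E. induction r as [|r IH]; cbn; intros f E; [eauto|].
  destruct f; cbn [code] in E; apply cpair_inj in E as [E1 E2]; try lia; eauto.
Qed.

Lemma code_bin_inv t x y f : code cs' f = cpair t (cpair x y) -> 4 <= t <= 6 ->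
  exists g h, code cs' g = x /\ code cs' h = y.
Proof.
  intros E T.
  destruct f; cbn [code] in E; apply cpair_inj in E as [E1 E2]; try lia;
    apply cpair_inj in E2 as []; eauto.
Qed.

(** By strong induction on the number: an error in a part becomes [junk] there, and no formula has a
    code built around a non-code, so the error survives to the top. *)
Lemma tr_code_cases x :
  (exists f, wf ar f /\ code cs f = x) \/ (forall g, code cs' g <> tr_code x).
Proof.
  induction x as [x IH] using lt_wf_ind.
  rewrite <- (cpair_eta x) in *. set (t := pfst x) in *. set (a := psnd x) in *.
  clearbody t a. clear x.
  assert (La : 0 < t -> a < cpair t a) by apply cpair_gt_r.
  pose proof (cpair_ge_l (pfst a) (psnd a)) as L1.
  pose proof (cpair_ge_r (pfst a) (psnd a)) as L2.
  rewrite cpair_eta in L1, L2.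
  assert (B : 4 <= t <= 6 ->
    (exists f g, wf ar f /\ wf ar g /\ cpair (code cs f) (code cs g) = a) \/
    (forall g, code cs' g <>
       cpair t (cpair (tr_code (pfst a)) (tr_code (psnd a))))).
  { intros T.
    destruct (IH (pfst a)) as [[f [Wf Ef]]|H]; [lia| |].
    - destruct (IH (psnd a)) as [[g [Wg Eg]]|H]; [lia| |].
      + left. exists f, g. rewrite Ef, Eg, cpair_eta. auto.
      + right. intros g E. destruct (code_bin_inv _ _ _ E T) as [? [h [_ F]]].
        exact (H _ F).
    - right. intros g E. destruct (code_bin_inv _ _ _ E T) as [h [? [F _]]].
      exact (H _ F). }
  destruct (le_lt_dec 9 t) as [T|T].
  { right. rewrite tr_code_eq. unfold sw.
    do 9 (destruct t as [|t]; [lia|]). cbn [Nat.eqb]. intros g. apply code_junk. }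
  rewrite tr_code_eq. unfold sw.
  destruct t as [|[|[|[|[|[|[|[|[|t]]]]]]]]]; cbn [Nat.eqb]; [..|lia].
  - left. exists (fEq _ (pfst a) (psnd a)). simpl. rewrite cpair_eta. auto.
  - destruct (rel_code_cases a) as [[s E]|E].
    + rewrite <- (cpair_eta a), E, rel_code_spec.
      destruct (bind_code_cases (ar s) 0 (code cs' (sig s)) (psnd a))
        as [[l [L H]]|H]; [left | right; exact H].
      exists (fRel s l). split; [exact L|]. cbn [code]. congruence.
    + right. intros g. rewrite E. apply code_junk.
  - destruct (Nat.eqb_spec a 0) as [->|N].
    + left. exists fFalse. split; simpl; auto.
    + right. intros g. apply code_junk.
  - destruct (IH a) as [[f [W E]]|H]; [lia| |].
    + left. exists (fNot f). split; auto. cbn [code]. congruence.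
    + right. intros g E. destruct g; cbn [code] in E; apply cpair_inj in E as [E1 E2];
        try discriminate. exact (H _ E2).
  - destruct B as [[f [g [Wf [Wg E]]]]|H]; [lia| |right; exact H].
    left. exists (fAnd f g). split; [split; auto|]. cbn [code]. congruence.
  - destruct B as [[f [g [Wf [Wg E]]]]|H]; [lia| |right; exact H].
    left. exists (fOr f g). split; [split; auto|]. cbn [code]. congruence.
  - destruct B as [[f [g [Wf [Wg E]]]]|H]; [lia| |right; exact H].
    left. exists (fImp f g). split; [split; auto|]. cbn [code]. congruence.
  - destruct (IH a) as [[f [W E]]|H]; [lia| |].
    + left. exists (fAll f). split; auto. cbn [code]. congruence.
    + right. intros g E. apply tag_iter_inv in E as [g' E]; auto.
      apply code_bin_inv in E as [? [h [_ E]]]; [|lia]. exact (H _ E).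
  - destruct (IH a) as [[f [W E]]|H]; [lia| |].
    + left. exists (fEx f). split; auto. cbn [code]. congruence.
    + right. intros g E. apply tag_iter_inv in E as [g' E]; auto.
      apply code_bin_inv in E as [? [h [_ E]]]; [|lia]. exact (H _ E).
Qed.

Theorem interpretation_reduction : many_one_le (FO ar cs M) (FO ar' cs' M').
Proof.
  exists (fun x => tag_iter 8 m (cpair 4 (cpair (code cs' Ax) (tr_code x)))).
  split.
  - apply Rec_computable. apply Rec_tag_iter. apply Rec_cpair; auto with rec.
    apply Rec_cpair; auto with rec. apply Rec_comp1; auto with rec.
    apply computable_tr_code.
  - intros x.
    assert (K : forall f, wf ar f -> code cs f = x ->
      tag_iter 8 m (cpair 4 (cpair (code cs' Ax) (tr_code x))) = code cs' (reduct f)).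
    { intros f W <-. unfold reduct. rewrite code_exs, tr_code_spec by exact W.
      reflexivity. }
    split.
    + intros [f [E [W [C T]]]]. rewrite (K f W E). exists (reduct f).
      repeat split; auto.
      * apply reduct_wf.
      * apply reduct_closed; auto.
      * apply reduct_true; auto.
    + intros [g [E [Wg [C T]]]].
      destruct (tr_code_cases x) as [[f [W Ef]]|H].
      * rewrite (K f W Ef) in E. apply code_inj in E as ->; [|exact cs_inj'].
        rewrite reduct_closed in C by exact W.
        exists f. repeat split; auto. apply reduct_true; auto.
      * exfalso. apply tag_iter_inv in E as [g' E]; auto.
        apply code_bin_inv in E as [? [h [_ E]]]; [|lia]. exact (H _ E).
Qed.
End Interpretation.

(** * Definable relations *)

Section Definability.
Variables (Sg : Type) (ar : Sg -> nat) (M : structure Sg).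

(** Definability is stated semantically: formulas are assembled by closure lemmas and proof search,
    and only the relations they define are ever inspected. *)
Definition Dfn (k : nat) (P : (nat -> dom M) -> Prop) : Prop :=
  exists f, wf ar f /\ closed_at k f /\ forall rho, sat M rho f <-> P rho.

Lemma dfn_ext k (P Q : (nat -> dom M) -> Prop) :
  (forall rho, P rho <-> Q rho) -> Dfn k P -> Dfn k Q.
Proof.
  intros E [f [W [C H]]]. exists f. repeat split; auto; intros K.
  - apply E, H, K.
  - apply H, E, K.
Qed.

Lemma dfn_rel k s l : length l = ar s -> Forall (fun i => i < k) l ->
  Dfn k (fun rho => drel M s (map rho l)).
Proof. intros L F. exists (fRel s l). simpl. repeat split; auto. Qed.

Lemma dfn_deq k i j : i < k -> j < k -> Dfn k (fun rho => deq M (rho i) (rho j)).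
Proof. intros I J. exists (fEq _ i j). simpl. repeat split; auto. Qed.

Lemma dfn_not k P : Dfn k P -> Dfn k (fun rho => ~ P rho).
Proof.
  intros [f [W [C H]]]. exists (fNot f). simpl. split; [auto|split; [auto|]].
  intros rho. rewrite H. tauto.
Qed.

Lemma dfn_and k P Q : Dfn k P -> Dfn k Q -> Dfn k (fun rho => P rho /\ Q rho).
Proof.
  intros [f [W [C H]]] [g [W' [C' H']]]. exists (fAnd f g). simpl.
  split; [auto|split; [auto|]]. intros rho. rewrite H, H'. tauto.
Qed.

Lemma dfn_or k P Q : Dfn k P -> Dfn k Q -> Dfn k (fun rho => P rho \/ Q rho).
Proof.
  intros [f [W [C H]]] [g [W' [C' H']]]. exists (fOr f g). simpl.
  split; [auto|split; [auto|]]. intros rho. rewrite H, H'. tauto.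
Qed.

Lemma dfn_imp k P Q : Dfn k P -> Dfn k Q -> Dfn k (fun rho => P rho -> Q rho).
Proof.
  intros [f [W [C H]]] [g [W' [C' H']]]. exists (fImp f g). simpl.
  split; [auto|split; [auto|]]. intros rho. rewrite H, H'. tauto.
Qed.

Lemma dfn_iff k P Q : Dfn k P -> Dfn k Q -> Dfn k (fun rho => P rho <-> Q rho).
Proof. intros HP HQ. apply dfn_and; apply dfn_imp; assumption. Qed.

Lemma dfn_all k (Q : dom M -> (nat -> dom M) -> Prop) :
  Dfn (S k) (fun r => Q (r 0) (fun i => r (S i))) ->
  Dfn k (fun rho => forall d, Q d rho).
Proof.
  intros [f [W [C H]]]. exists (fAll f). simpl. split; [auto|split; [auto|]].
  intros rho. split; intros K d; apply (H (scons d rho)), K.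
Qed.

Lemma dfn_ex k (Q : dom M -> (nat -> dom M) -> Prop) :
  Dfn (S k) (fun r => Q (r 0) (fun i => r (S i))) ->
  Dfn k (fun rho => exists d, Q d rho).
Proof.
  intros [f [W [C H]]]. exists (fEx f). simpl. split; [auto|split; [auto|]].
  intros rho. split; intros [d K]; exists d; apply (H (scons d rho)), K.
Qed.

Definition up_ren (xi : nat -> nat) (i : nat) : nat :=
  match i with 0 => 0 | S i => S (xi i) end.

Fixpoint ren (xi : nat -> nat) (f : form Sg) : form Sg :=
  match f with
  | fEq _ i j => fEq _ (xi i) (xi j)
  | fRel s l => fRel s (map xi l)
  | fFalse => fFalse
  | fNot g => fNot (ren xi g)
  | fAnd g h => fAnd (ren xi g) (ren xi h)
  | fOr g h => fOr (ren xi g) (ren xi h)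
  | fImp g h => fImp (ren xi g) (ren xi h)
  | fAll g => fAll (ren (up_ren xi) g)
  | fEx g => fEx (ren (up_ren xi) g)
  end.

Lemma sat_ren f : forall xi rho, sat M rho (ren xi f) <-> sat M (fun i => rho (xi i)) f.
Proof.
  assert (U : forall d (rho : nat -> dom M) xi,
    (fun i => scons d rho (up_ren xi i)) = scons d (fun i => rho (xi i))).
  { intros. apply functional_extensionality. intros []; reflexivity. }
  induction f; intros xi rho; cbn [ren sat];
    rewrite ?IHf, ?IHf1, ?IHf2; try tauto.
  - rewrite map_map. tauto.
  - split; intros H d; specialize (H d); rewrite IHf, U in *; assumption.
  - split; intros [d H]; exists d; rewrite IHf, U in *; assumption.
Qed.

Lemma wf_ren f xi : wf ar f -> wf ar (ren xi f).
Proof.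
  revert xi. induction f; simpl; intros xi; auto; try (intros []; auto).
  rewrite length_map. auto.
Qed.

Lemma closed_ren f r k xi : (forall i, i < r -> xi i < k) ->
  closed_at r f -> closed_at k (ren xi f).
Proof.
  revert r k xi. induction f; cbn [ren closed_at]; intros r k xi X; auto;
    try (intros []; eauto; fail).
  - intros C. apply Forall_map. eapply Forall_impl; [|exact C]. auto.
  - eauto.
  - apply IHf. intros [|i] I; simpl; [lia|]. apply -> Nat.succ_lt_mono. apply X. lia.
  - apply IHf. intros [|i] I; simpl; [lia|]. apply -> Nat.succ_lt_mono. apply X. lia.
Qed.

Lemma dfn_ren r k P xi : Dfn r P -> (forall i, i < r -> xi i < k) ->
  Dfn k (fun rho => P (fun i => rho (xi i))).
Proof.
  intros [f [W [C H]]] X. exists (ren xi f). repeat split.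
  - apply wf_ren, W.
  - eapply closed_ren; eauto.
  - intros K. apply H, sat_ren, K.
  - intros K. apply sat_ren, H, K.
Qed.
End Definability.

Arguments dfn_rel {Sg} ar M {k} s l _ _.
Arguments dfn_ren {Sg ar M r k P} xi _ _.

Create HintDb dfn.

Ltac bounds := repeat (apply Forall_cons; [lia|]); apply Forall_nil.

Ltac dfn_connective :=
  cbv beta;
  lazymatch goal with
  | |- Dfn _ _ _ (fun rho => @?A rho /\ @?B rho) => apply dfn_and
  | |- Dfn _ _ _ (fun rho => @?A rho \/ @?B rho) => apply dfn_or
  | |- Dfn _ _ _ (fun rho => @?A rho <-> @?B rho) => apply dfn_iff
  | |- Dfn _ _ _ (fun rho => ~ @?A rho) => apply dfn_not
  | |- Dfn _ _ _ (fun rho => @?A rho -> @?B rho) => apply dfn_imp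
  end.

(** * Definability in second-order arithmetic *)

Notation DfnN := (Dfn n2_ar N2).

Lemma deq_N2 a b : deq N2 a b <-> a = b.
Proof.
  destruct a as [a|A], b as [b|B]; simpl; split; intros H; try easy; try congruence.
  - f_equal. apply functional_extensionality. intros k.
    apply propositional_extensionality, H.
  - injection H as ->. tauto.
Qed.

Definition numval (d : N2dom) : nat := match d with inl a => a | inr _ => 0 end.
Definition mem (d : N2dom) (a : nat) : Prop :=
  match d with inl _ => False | inr X => X a end.

Lemma dfn_eqN k i j : i < k -> j < k -> DfnN k (fun rho => rho i = rho j).
Proof.
  intros I J. eapply dfn_ext; [|apply dfn_deq; [exact I | exact J]].
  intros rho. apply deq_N2.
Qed.

(** Relativisation to the numbers is avoided, since [numval] maps the whole domain onto [nat],
    reading sets as 0. *)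
Lemma dfn_alln k (Q : nat -> (nat -> N2dom) -> Prop) :
  DfnN (S k) (fun r => Q (numval (r 0)) (fun i => r (S i))) ->
  DfnN k (fun rho => forall a, Q a rho).
Proof.
  intros H. apply dfn_all with (Q := fun d => Q (numval d)) in H.
  eapply dfn_ext; [|exact H]. intros rho. split; intros K a; [|apply K].
  exact (K (inl a)).
Qed.

Lemma dfn_exn k (Q : nat -> (nat -> N2dom) -> Prop) :
  DfnN (S k) (fun r => Q (numval (r 0)) (fun i => r (S i))) ->
  DfnN k (fun rho => exists a, Q a rho).
Proof.
  intros H. apply dfn_ex with (Q := fun d => Q (numval d)) in H.
  eapply dfn_ext; [|exact H]. intros rho. split; intros [a K]; [eauto|].
  exists (inl a). exact K.
Qed.

(** The signature is purely relational, so a term is represented by its definable graph, with the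
    value at index 0. *)
Definition Tm (k : nat) (t : (nat -> N2dom) -> nat) : Prop :=
  DfnN (S k) (fun r => r 0 = inl (t (fun i => r (S i)))).

Lemma tm_weaken k t : Tm k t -> Tm (S k) (fun r => t (fun i => r (S i))).
Proof.
  intros H.
  (* The value stays at index 0, and index 1 is left to the new variable. *)
  refine (dfn_ren (fun i => match i with 0 => 0 | S j => S (S j) end) H _).
  intros []; lia.
Qed.

Lemma tm_ex k t (Q : N2dom -> (nat -> N2dom) -> Prop) : Tm k t ->
  DfnN (S k) (fun r => Q (r 0) (fun i => r (S i))) ->
  DfnN k (fun rho => Q (inl (t rho)) rho).
Proof.
  intros T H. eapply dfn_ext;
    [|exact (dfn_ex (M := N2) (fun d rho => d = inl (t rho) /\ Q d rho) (dfn_and T H))].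
  intros rho. split.
  - intros [d [E K]]. rewrite <- E. exact K.
  - intros K. exists (inl (t rho)). auto.
Qed.

Lemma dfn_eqn k t t' : Tm k t -> Tm k t' -> DfnN k (fun rho => t rho = t' rho).
Proof.
  intros T T'. eapply dfn_ext; [|exact (tm_ex (fun d rho => d = inl (t' rho)) T T')].
  intros rho. split; congruence.
Qed.

Lemma tm_numval k i : i < k -> Tm k (fun rho => numval (rho i)).
Proof.
  intros I. unfold Tm.
  assert (B : forall j, j < S k -> DfnN (S k) (fun r => n2_rel NNat [r j])).
  { intros j J. refine (dfn_rel n2_ar N2 NNat [j] eq_refl _). auto. }
  (* Only the number 0 satisfies [x + x = x]; it is the value assigned when the variable holds a
     set. *)
  assert (Z : DfnN (S k) (fun r => n2_rel NAdd [r 0; r 0; r 0])).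
  { refine (dfn_rel n2_ar N2 NAdd [0; 0; 0] eq_refl _). bounds. }
  eapply dfn_ext; [|exact (dfn_or
    (dfn_and (B (S i) ltac:(lia)) (@dfn_eqN (S k) 0 (S i) ltac:(lia) ltac:(lia)))
    (dfn_and (dfn_not (B (S i) ltac:(lia))) Z))].
  intros r. cbv beta. destruct (r (S i)) as [a|A]; cbn.
  - intuition.
  - destruct (r 0) as [b|B']; [|intuition discriminate].
    split; [intros [[]|[_ E]]; f_equal; lia|]. intros E. injection E as ->. auto.
Qed.

Lemma tm_op k s (op : nat -> nat -> nat) t t' : n2_ar s = 3 ->
  (forall a b d, n2_rel s [inl a; inl b; d] <-> d = inl (op a b)) ->
  Tm k t -> Tm k t' -> Tm k (fun rho => op (t rho) (t' rho)).
Proof.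
  intros A O T T'.
  pose (Q := fun d rho => n2_rel s [d; inl (t' (fun i => rho (S i))); rho 0]).
  eapply dfn_ext; [|refine (tm_ex Q (tm_weaken T)
    (tm_ex (fun d r => n2_rel s [r 0; d; r 1]) (tm_weaken (tm_weaken T'))
      (dfn_rel n2_ar N2 s [1; 0; 2] (eq_sym A) _))); bounds].
  intros rho. unfold Q. apply O.
Qed.

Lemma tm_add k t t' : Tm k t -> Tm k t' -> Tm k (fun rho => t rho + t' rho).
Proof.
  apply (@tm_op k NAdd Nat.add); [reflexivity|].
  intros a b [d|D]; cbn; split; intros E; try easy; [now rewrite E | now injection E].
Qed.

Lemma tm_mul k t t' : Tm k t -> Tm k t' -> Tm k (fun rho => t rho * t' rho).
Proof.
  apply (@tm_op k NMul Nat.mul); [reflexivity|].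
  intros a b [d|D]; cbn; split; intros E; try easy; [now rewrite E | now injection E].
Qed.

Lemma tm_const k c : Tm k (fun _ => c).
Proof.
  assert (Z : Tm k (fun _ => 0)).
  { eapply dfn_ext; [|refine (dfn_rel n2_ar N2 NAdd [0; 0; 0] eq_refl _);
      bounds].
    intros r. cbn. destruct (r 0) as [a|A]; split; try easy.
    - intros E. f_equal. lia.
    - intros E. injection E as ->. reflexivity. }
  (* The number 1 is the nonzero solution of [x * x = x]. *)
  assert (O : Tm k (fun _ => 1)).
  { eapply dfn_ext; [|refine (dfn_and (dfn_rel n2_ar N2 NMul [0; 0; 0] eq_refl _)
      (dfn_not Z)); bounds].
    intros r. cbn. destruct (r 0) as [a|A]; split; try easy.
    - intros [E N]. f_equal. assert (a <> 0) by (intros ->; apply N; reflexivity). nia.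
    - intros E. injection E as ->. split; [reflexivity|]. intros E. discriminate E. }
  induction c as [|c IH]; [exact Z|]. rewrite <- Nat.add_1_r. apply tm_add; assumption.
Qed.

Lemma tm_S k t : Tm k t -> Tm k (fun rho => S (t rho)).
Proof.
  intros T. eapply dfn_ext; [|exact (tm_add T (tm_const k 1))].
  intros r. cbv beta. rewrite Nat.add_1_r. tauto.
Qed.

Lemma dfn_le k t t' : Tm k t -> Tm k t' -> DfnN k (fun rho => t rho <= t' rho).
Proof.
  intros T T'.
  eapply dfn_ext; [|apply (dfn_exn (fun a rho => t rho + a = t' rho))].
  - intros rho. split; [intros [a E]; lia|]. intros L. exists (t' rho - t rho). lia.
  - apply dfn_eqn; [apply tm_add|]; try (apply tm_weaken; assumption).
    apply tm_numval. lia.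
Qed.

Lemma dfn_mem k i t : i < k -> Tm k t -> DfnN k (fun rho => mem (rho i) (t rho)).
Proof.
  intros I T. eapply dfn_ext; [|refine (tm_ex (fun d rho => n2_rel NIn [d; rho i]) T
    (dfn_rel n2_ar N2 NIn [0; S i] eq_refl _)); bounds].
  intros rho. cbn. destruct (rho i); cbn; tauto.
Qed.

#[global] Hint Resolve tm_numval tm_add tm_mul tm_const tm_S dfn_le dfn_mem dfn_eqn
  dfn_eqN : dfn.
#[global] Hint Extern 1 (_ < _) => lia : dfn.

Ltac dfnN := repeat first
  [ dfn_connective
  | lazymatch goal with
    | |- DfnN _ (fun rho => forall a : nat, _) => apply dfn_alln
    | |- DfnN _ (fun rho => exists a : nat, _) => apply dfn_exn
    end
  | solve [auto 20 with dfn] ].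

(** * Open sets coded by sets of numbers *)

Section Coordinates.
Open Scope R_scope.

Lemma sumFin_nonneg n (f : Fin.t n -> R) : (forall i, 0 <= f i) -> 0 <= sumFin f.
Proof.
  induction n as [|n IH]; simpl; intros H; [lra|].
  specialize (IH (fun i => f (Fin.FS i)) (fun i => H _)). specialize (H Fin.F1). lra.
Qed.

Lemma sumFin_term n (f : Fin.t n -> R) i : (forall i, 0 <= f i) -> f i <= sumFin f.
Proof.
  induction i as [n|n i IH]; simpl; intros H.
  - pose proof (sumFin_nonneg (fun i => f (Fin.FS i)) (fun i => H _)). lra.
  - specialize (IH (fun i => f (Fin.FS i)) (fun i => H _)). specialize (H Fin.F1).
    simpl in IH. lra.
Qed.

Lemma sumFin_bound n (f : Fin.t n -> R) c : (forall i, f i <= c) -> sumFin f <= INR n * c.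
Proof.
  induction n as [|n IH]; intros H; [simpl; lra|].
  specialize (IH (fun i => f (Fin.FS i)) (fun i => H _)). specialize (H Fin.F1).
  rewrite S_INR. simpl. lra.
Qed.

Lemma coord_le_edist n (x y : point n) i : Rabs (x i - y i) <= edist x y.
Proof.
  unfold edist. rewrite <- sqrt_Rsqr_abs. apply sqrt_le_1_alt.
  replace (Rsqr (x i - y i)) with ((x i - y i) ^ 2) by (unfold Rsqr; ring).
  apply (sumFin_term (fun i => (x i - y i) ^ 2)). intros. apply pow2_ge_0.
Qed.

Lemma edist_small n eps : 0 < eps -> exists delta, 0 < delta /\
  forall x y : point n, (forall i, Rabs (x i - y i) < delta) -> edist x y < eps.
Proof.
  intros E. pose proof (pos_INR n) as N.
  (* The sum of [n] squares below [d ^ 2] stays strictly below [((n + 1) * d) ^ 2]; the added 1 also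
     covers dimension 0. *)
  exists (eps / (INR n + 1)). split.
  { apply Rdiv_lt_0_compat; lra. }
  intros x y H. set (d := eps / (INR n + 1)) in *.
  assert (D : eps = (INR n + 1) * d) by (unfold d; field; lra).
  assert (B : sumFin (fun i => (x i - y i) ^ 2) <= INR n * d ^ 2).
  { apply sumFin_bound. intros i. specialize (H i). rewrite <- (pow2_abs (x i - y i)).
    pose proof (Rabs_pos (x i - y i)). nra. }
  unfold edist. rewrite <- (sqrt_Rsqr eps) by lra. apply sqrt_lt_1_alt. split.
  - apply sumFin_nonneg. intros. apply pow2_ge_0.
  - eapply Rle_lt_trans; [exact B|]. rewrite D. unfold Rsqr.
    assert (0 < d) by (rewrite D in E; nra). nra.
Qed.

Lemma is_open_coord n (U : point n -> Prop) :
  (forall x, U x -> exists eps, 0 < eps /\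
     forall y, (forall i, Rabs (x i - y i) < eps) -> U y) -> is_open U.
Proof.
  intros H x Ux. destruct (H x Ux) as [eps [E K]]. exists eps. split; [exact E|].
  intros y D. apply K. intros i. pose proof (coord_le_edist x y i). lra.
Qed.

Lemma is_open_coord_inv n (U : point n -> Prop) x : is_open U -> U x ->
  exists eps, 0 < eps /\ forall y, (forall i, Rabs (x i - y i) < eps) -> U y.
Proof.
  intros O Ux. destruct (O x Ux) as [eps [E K]].
  destruct (edist_small n E) as [d [D L]]. exists d. split; auto.
Qed.

Lemma INR_S_pos k : 0 < INR (S k).
Proof. apply lt_0_INR. lia. Qed.

Lemma small_inverse eps : 0 < eps -> exists e, / INR (S e) < eps.
Proof.
  intros E. destruct (archimed_cor1 eps E) as [[|e] [H L]]; [lia|]. eauto.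
Qed.

Definition frac (a b c : nat) : R := (INR a - INR b) / INR (S c).

Lemma frac_dense x eps : 0 < eps -> exists a b c, x - eps < frac a b c < x.
Proof.
  intros E. destruct (@small_inverse (eps / 2)) as [c C]; [lra|].
  pose proof (INR_S_pos c) as P. set (N := INR (S c)) in *.
  (* Subtracting 2 puts [z] at least 1 below [x * N], which makes the fraction strictly smaller than
     [x], and less than 2 below it, an error under [2 / N < eps]. *)
  destruct (archimed (x * N)) as [A1 A2]. set (z := (up (x * N) - 2)%Z).
  exists (Z.to_nat z), (Z.to_nat (- z)), c. unfold frac. fold N.
  replace (INR (Z.to_nat z) - INR (Z.to_nat (- z))) with (IZR z).
  2:{ rewrite !INR_IZR_INZ, <- minus_IZR. f_equal. lia. }
  assert (Z : x * N - 2 < IZR z <= x * N - 1).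
  { unfold z. rewrite minus_IZR. lra. }
  assert (I : / N * N = 1) by (field; lra).
  assert (F : IZR z / N * N = IZR z) by (field; lra).
  split; apply Rmult_lt_reg_r with N; auto; rewrite F; nra.
Qed.
End Coordinates.

Definition idx (n : nat) (i : Fin.t n) : nat := proj1_sig (Fin.to_nat i).

Lemma idx_lt n (i : Fin.t n) : idx i < n.
Proof. apply (proj2_sig (Fin.to_nat i)). Qed.

Lemma idx_inj n (i j : Fin.t n) : idx i = idx j -> i = j.
Proof. apply Fin.to_nat_inj. Qed.

Lemma idx_onto n k : k < n -> exists i : Fin.t n, idx i = k.
Proof.
  intros L. exists (Fin.of_nat_lt L). unfold idx. rewrite Fin.to_nat_of_nat. reflexivity.
Qed.

(** Unlike [cpair], this pairing is a polynomial and hence directly a term of arithmetic. It is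
    injective because its value lies between the consecutive squares of [a + b] and [a + b + 1]. *)
Definition pr (a b : nat) : nat := (a + b) * (a + b) + a.

Lemma pr_inj a b c d : pr a b = pr c d -> a = c /\ b = d.
Proof.
  unfold pr. intros E. assert (S : a + b = c + d).
  { destruct (Nat.lt_trichotomy (a + b) (c + d)) as [L|[L|L]]; auto; nia. }
  rewrite S in E. lia.
Qed.

Definition entry (j i a b c : nat) : nat := pr j (pr i (pr a (pr b c))).

Lemma entry_inj j i a b c j' i' a' b' c' :
  entry j i a b c = entry j' i' a' b' c' ->
  j = j' /\ i = i' /\ a = a' /\ b = b' /\ c = c'.
Proof.
  unfold entry. intros E. apply pr_inj in E as [-> E]. apply pr_inj in E as [-> E].
  apply pr_inj in E as [-> E]. apply pr_inj in E as [-> ->]. auto.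
Qed.

(* A set [X] of numbers codes the closed set which is the closure of the points
   [x] of [site X j x]: the [i]-th coordinate of the [j]-th point is the supremum
   of the fractions [(a - b) / (c + 1)] with [entry j i a b c] in [X]. *)
Section OpenCodes.
Variable n : nat.

(** In every coordinate the fractions are nonempty and bounded above by an integer [B], the
    inequality being [(a - b) / (c + 1) <= B] without denominators. This is the condition for the
    suprema to exist. *)
Definition valid (X : N2dom) (j : nat) : Prop :=
  forall i, i < n ->
    (exists a b c, mem X (entry j i a b c)) /\
    exists B, forall a b c, mem X (entry j i a b c) -> a <= b + B * S c.

(** With denominators cleared, each fraction on the side of [X] is at most [1 / (e + 1)] above some
    fraction on the side of [Y]. *)
Definition below (X : N2dom) (j : nat) (Y : N2dom) (j' i e : nat) : Prop :=
  forall a b c, mem X (entry j i a b c) ->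
  exists a' b' c', mem Y (entry j' i a' b' c') /\
    a * S c' * S e + b' * S c * S e <= a' * S c * S e + b * S c' * S e + S c * S c'.

(** The codes describe complements, so the inclusion is reversed: the points coded by [Y] must be
    approximable by points coded by [X]. *)
Definition sub_code (X Y : N2dom) : Prop :=
  forall j, valid Y j -> forall e, exists j', valid X j' /\
    forall i, i < n -> below Y j X j' i e /\ below X j' Y j i e.

Lemma dfn_sub_code k s t : s < k -> t < k ->
  DfnN k (fun rho => sub_code (rho s) (rho t)).
Proof.
  intros S T. unfold sub_code, valid, below, entry, pr, lt. dfnN.
Qed.

Open Scope R_scope.

Definition slice (X : N2dom) (j i : nat) (q : R) : Prop :=
  exists a b c, mem X (entry j i a b c) /\ q = frac a b c.

Definition site (X : N2dom) (j : nat) (x : point n) : Prop :=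
  forall i : Fin.t n, is_lub (slice X j (idx i)) (x i).

Lemma frac_le_bound a b c B : (a <= b + B * S c)%nat <-> frac a b c <= INR B.
Proof.
  unfold frac. pose proof (INR_S_pos c) as P.
  assert (F : (INR a - INR b) / INR (S c) * INR (S c) = INR a - INR b) by (field; lra).
  split; intros H.
  - apply le_INR in H. rewrite plus_INR, mult_INR in H. nra.
  - apply INR_le. rewrite plus_INR, mult_INR. nra.
Qed.

Lemma frac_le_approx a b c a' b' c' e :
  (a * S c' * S e + b' * S c * S e <= a' * S c * S e + b * S c' * S e + S c * S c')%nat
  <-> frac a b c <= frac a' b' c' + / INR (S e).
Proof.
  unfold frac.
  pose proof (INR_S_pos c) as P. pose proof (INR_S_pos c') as P'.
  pose proof (INR_S_pos e) as Q.
  assert (D : (INR a' - INR b') / INR (S c') + / INR (S e) - (INR a - INR b) / INR (S c)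
    = (INR a' * INR (S c) * INR (S e) + INR b * INR (S c') * INR (S e)
        + INR (S c) * INR (S c')
       - (INR a * INR (S c') * INR (S e) + INR b' * INR (S c) * INR (S e)))
      / (INR (S c) * INR (S c') * INR (S e))) by (field; lra).
  assert (K : 0 < INR (S c) * INR (S c') * INR (S e)).
  { repeat apply Rmult_lt_0_compat; assumption. }
  split; intros H.
  - apply le_INR in H. rewrite !plus_INR, !mult_INR in H.
    apply Rge_le, Rminus_ge, Rle_ge. rewrite D.
    apply Rmult_le_pos; [lra|]. apply Rlt_le, Rinv_0_lt_compat, K.
  - apply INR_le. rewrite !plus_INR, !mult_INR.
    apply Rge_le, Rminus_ge, Rle_ge.
    assert (H' : 0 <= (INR a' - INR b') / INR (S c') + / INR (S e)
      - (INR a - INR b) / INR (S c)) by lra.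
    rewrite D in H'. apply Rmult_le_reg_r with (/ (INR (S c) * INR (S c') * INR (S e))).
    + apply Rinv_0_lt_compat, K.
    + rewrite Rmult_0_l. exact H'.
Qed.

Lemma valid_site X j : valid X j <-> exists x, site X j x.
Proof.
  split.
  - intros V. apply (choice (fun i u => is_lub (slice X j (idx i)) u)).
    intros i. destruct (V (idx i) (idx_lt i)) as [[a [b [c H]]] [B HB]].
    destruct (completeness (slice X j (idx i))) as [u U]; [| |eauto].
    + exists (INR B). intros q [a' [b' [c' [M ->]]]].
      apply frac_le_bound, HB, M.
    + exists (frac a b c), a, b, c. auto.
  - intros [x H] k K. destruct (idx_onto K) as [i <-]. destruct (H i) as [U L]. split.
    + apply NNPP. intros N.
      assert (W : is_upper_bound (slice X j (idx i)) (x i - 1)).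
      { intros q [a [b [c [M _]]]]. exfalso. apply N. eauto. }
      apply L in W. lra.
    + destruct (INR_unbounded (x i)) as [B HB]. exists B. intros a b c M.
      apply frac_le_bound. apply Rle_trans with (x i); [|lra].
      apply U. exists a, b, c. auto.
Qed.

Lemma below_le X j Y j' i e u v :
  is_lub (slice X j i) u -> is_lub (slice Y j' i) v ->
  below X j Y j' i e -> u <= v + / INR (S e).
Proof.
  intros [_ L] [U _] B. apply L. intros q [a [b [c [M ->]]]].
  destruct (B a b c M) as [a' [b' [c' [M' H]]]]. apply frac_le_approx in H.
  assert (frac a' b' c' <= v) by (apply U; exists a', b', c'; auto). lra.
Qed.

(** The strict inequality compensates for suprema that are not attained: a fraction exceeding all
    those of [Y] by more than [1 / (e + 1)] would force [v + 1 / (e + 1) <= u]. *)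
Lemma lt_below X j Y j' i e u v :
  is_lub (slice X j i) u -> is_lub (slice Y j' i) v ->
  u < v + / INR (S e) -> below X j Y j' i e.
Proof.
  intros [U _] [_ L] H a b c M. apply NNPP. intros N.
  assert (Q : frac a b c <= u) by (apply U; exists a, b, c; auto).
  assert (W : is_upper_bound (slice Y j' i) (frac a b c - / INR (S e))).
  { intros q [a' [b' [c' [M' ->]]]].
    destruct (Rle_lt_dec (frac a b c) (frac a' b' c' + / INR (S e))) as [K|K]; [|lra].
    exfalso. apply N. exists a', b', c'. split; auto. apply frac_le_approx, K. }
  apply L in W. lra.
Qed.

Definition in_closure (X : N2dom) (x : point n) : Prop :=
  forall eps, 0 < eps -> exists j y, site X j y /\ forall i, Rabs (x i - y i) < eps.

Lemma closure_compl_open X : is_open (fun x => ~ in_closure X x).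
Proof.
  apply is_open_coord. intros x N. apply not_all_ex_not in N as [eps N].
  apply imply_to_and in N as [E N]. exists (eps / 2). split; [lra|].
  intros y D C. apply N. destruct (C (eps / 2)) as [j [z [S Z]]]; [lra|].
  exists j, z. split; auto. intros i. specialize (D i). specialize (Z i).
  replace (x i - z i) with (x i - y i + (y i - z i)) by ring.
  pose proof (Rabs_triang (x i - y i) (y i - z i)). lra.
Qed.

Lemma sub_code_spec X Y :
  sub_code X Y <-> forall x, in_closure Y x -> in_closure X x.
Proof.
  split.
  - intros H x C eps E. destruct (@small_inverse (eps / 2)) as [e He]; [lra|].
    destruct (C (eps / 2)) as [j [y [Sy D]]]; [lra|].
    destruct (H j) with (e := e) as [j' [V B]]; [apply valid_site; eauto|].
    apply valid_site in V as [z Sz]. exists j', z. split; auto. intros i.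
    destruct (B (idx i) (idx_lt i)) as [B1 B2].
    pose proof (below_le (Sy i) (Sz i) B1). pose proof (below_le (Sz i) (Sy i) B2).
    specialize (D i). apply Rabs_def2 in D. apply Rabs_def1; lra.
  - intros H j V e. apply valid_site in V as [y Sy].
    assert (C : in_closure Y y).
    { intros eps E. exists j, y. split; auto. intros i.
      rewrite Rminus_diag, Rabs_R0. exact E. }
    destruct (H y C (/ INR (S e))) as [j' [z [Sz D]]].
    { apply Rinv_0_lt_compat, INR_S_pos. }
    exists j'. split; [apply valid_site; eauto|]. intros k K.
    destruct (idx_onto K) as [i <-]. specialize (D i). apply Rabs_def2 in D.
    split; [apply (lt_below e (Sy i) (Sz i)) | apply (lt_below e (Sz i) (Sy i))]; lra.
Qed.
End OpenCodes.

(** * Every open set has a code *)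

Section Separability.
Open Scope R_scope.

Lemma dense_sequence n : exists g : nat -> point n,
  forall x eps, 0 < eps -> exists k, forall i, Rabs (g k i - x i) < eps.
Proof.
  induction n as [|n [g G]].
  - exists (fun _ _ => 0). intros x eps E. exists 0%nat. intros i. inversion i.
  - pose (q := fun k => frac (pfst k) (pfst (psnd k)) (psnd (psnd k))).
    exists (fun k i => Fin.caseS' i (fun _ => R) (q (pfst k)) (g (psnd k))).
    intros x eps E. destruct (G (fun i => x (Fin.FS i)) eps E) as [k K].
    destruct (frac_dense (x Fin.F1) E) as [a [b [c F]]].
    exists (cpair (cpair a (cpair b c)) k). rewrite pfst_cpair, psnd_cpair.
    intros i. apply (Fin.caseS' i); simpl; [|exact K].
    unfold q. rewrite !psnd_cpair, !pfst_cpair. apply Rabs_def1; lra.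
Qed.

Lemma open_coded n (U : point n -> Prop) : (0 < n)%nat -> is_open U ->
  exists X, forall x, U x <-> ~ in_closure (inr X) x.
Proof.
  intros N O. destruct (dense_sequence n) as [g G].
  destruct (idx_onto N) as [i0 _].
  (* The index [j] is a pair of [k] and [e]. It asks for a point outside [U] that is within
     [1 / (e + 1)] of the [k]-th dense point in each coordinate. If there is none, [j] gets no
     entries and is invalid. The points found are dense in the complement. *)
  pose (P := fun j (y : point n) =>
    ~ U y /\ forall i, Rabs (g (pfst j) i - y i) < / INR (S (psnd j))).
  destruct (choice (fun j y => (exists z, P j z) -> P j y)) as [ch Ch].
  { intros j. destruct (classic (exists z, P j z)) as [[z Z]|Z]; eauto.
    exists (fun _ => 0). tauto. }
  exists (fun m => exists j (i : Fin.t n) a b c,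
    m = entry j (idx i) a b c /\ P j (ch j) /\ frac a b c < ch j i).
  set (X := inr _).
  assert (M : forall j (i : Fin.t n) a b c, mem X (entry j (idx i) a b c) <->
    P j (ch j) /\ frac a b c < ch j i).
  { intros j i a b c. simpl. split.
    - intros [j' [i' [a' [b' [c' [E H]]]]]].
      apply entry_inj in E as [-> [E [-> [-> ->]]]]. apply idx_inj in E as ->. exact H.
    - intros H. exists j, i, a, b, c. auto. }
  assert (S1 : forall j, P j (ch j) -> site X j (ch j)).
  { intros j Pj i. split.
    - intros q [a [b [c [H ->]]]]. apply M in H. lra.
    - intros u H. destruct (Rle_lt_dec (ch j i) u) as [L|L]; [exact L|exfalso].
      destruct (@frac_dense (ch j i) (ch j i - u)) as [a [b [c F]]]; [lra|].
      assert (frac a b c <= u); [|lra]. apply H. exists a, b, c. split; auto.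
      apply M. split; [exact Pj | lra]. }
  assert (S2 : forall j y, site X j y -> P j (ch j) /\ forall i, y i = ch j i).
  { intros j y H.
    assert (Pj : P j (ch j)).
    { assert (V : valid n X j) by (apply valid_site; eauto).
      (* An index without a point is recognised by an empty slice, which takes at least one
         coordinate: here [0 < n] enters. *)
      destruct (V (idx i0) (idx_lt i0)) as [[a [b [c K]]] _]. apply M in K. tauto. }
    split; auto. intros i. eapply is_lub_u; [apply H | apply S1, Pj]. }
  intros x. split.
  - intros Ux C. destruct (is_open_coord_inv x O Ux) as [eps [E K]].
    destruct (C eps E) as [j [y [Sy D]]]. apply S2 in Sy as [[NU _] Ey].
    apply NU. apply K. intros i. rewrite <- Ey. apply D.
  - intros C. apply NNPP. intros NU. apply C. intros eps E.
    destruct (@small_inverse (eps / 2)) as [e He]; [lra|].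
    destruct (G x (/ INR (S e))) as [k K].
    { apply Rinv_0_lt_compat, INR_S_pos. }
    pose (j := cpair k e).
    assert (Pj : P j (ch j)).
    { apply Ch. exists x. split; auto. unfold j. rewrite pfst_cpair, psnd_cpair. exact K. }
    exists j, (ch j). split; [apply S1, Pj|]. intros i. destruct Pj as [_ D].
    specialize (D i). specialize (K i). unfold j in D at 1 3.
    rewrite pfst_cpair, psnd_cpair in D.
    replace (x i - ch j i) with (- (g k i - x i) + (g k i - ch j i)) by ring.
    pose proof (Rabs_triang (- (g k i - x i)) (g k i - ch j i)) as T.
    rewrite Rabs_Ropp in T. fold j in D. lra.
Qed.
End Separability.

Theorem lattice_le_N2 n : 0 < n ->
  many_one_le (FO lat_ar lat_code (Sigma01 n)) (FO n2_ar n2_code N2).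
Proof.
  intros N.
  (* Arguments arrive reversed, so index 1 is the first one and [f] is inclusion; [g] is its
     converse, and together they define equality. *)
  destruct (@dfn_sub_code n 2 1 0 ltac:(lia) ltac:(lia)) as [f [Wf [Cf Hf]]].
  destruct (@dfn_sub_code n 2 0 1 ltac:(lia) ltac:(lia)) as [g [Wg [Cg Hg]]].
  pose (rep := fun (_ : nat -> N2dom) (y : N2dom) (d : opens n) =>
    forall x, proj1_sig d x <-> ~ in_closure y x).
  assert (SR : forall p y y' d d', rep p y d -> rep p y' d' ->
    (sub_code n y y' <-> forall x, proj1_sig d x -> proj1_sig d' x)).
  { intros p y y' d d' H H'. rewrite sub_code_spec. split; intros K x.
    - rewrite (H x), (H' x). intros A B. apply A, K, B.
    - intros A. apply NNPP. intros B. apply (H x), K in B. apply (H' x) in B. tauto. }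
  refine (@interpretation_reduction LatSym N2Sym lat_ar lat_code n2_ar n2_code
    (Sigma01 n) N2 _ _ [LSub] _ 0 (fNot fFalse) (fAnd f g) (fun _ => f)
    _ _ _ _ _ _ deq_N2 rep _ _ _ _ _).
  - intros [] []; reflexivity.
  - intros [] []; simpl; congruence.
  - intros []. simpl. auto.
  - exact I.
  - exact I.
  - simpl. auto.
  - simpl. auto.
  - auto.
  - auto.
  - exists (fun _ => inl 0). simpl. auto.
  - intros p _ y. exists (exist _ _ (@closure_compl_open n y)). intros x. simpl. tauto.
  - intros p _ [U O]. destruct (open_coded N O) as [X H]. exists (inr X). exact H.
  - intros p _ rho _ y0 y1 x0 x1 R0 R1. cbn [sat]. rewrite Hf, Hg. cbn.
    rewrite (SR p _ _ _ _ R0 R1), (SR p _ _ _ _ R1 R0).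
    split; [intros [A B] x; split; auto | intros A; split; apply A].
  - intros p _ rho _ [] ys xs L F. rewrite Hf.
    destruct F as [|y0 x0 ys xs R0 F]; [discriminate|].
    destruct F as [|y1 x1 ys xs R1 F]; [discriminate|].
    destruct F as [|y2 x2 ys xs R2 F]; [|discriminate].
    cbn. apply (SR p); assumption.
Qed.

(** * Second-order arithmetic in the lattice of open sets *)

Section LatticePredicates.
Variable n : nat.
Notation O := (opens n).
Notation DfnL := (Dfn lat_ar (Sigma01 n)).

Lemma opens_ext (U V : O) : (forall x, proj1_sig U x <-> proj1_sig V x) -> U = V.
Proof.
  destruct U as [U HU], V as [V HV]. simpl. intros H.
  assert (E : U = V).
  { apply functional_extensionality. intros x. apply propositional_extensionality, H. }
  subst V. f_equal. apply proof_irrelevance.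
Qed.

Lemma deq_opens (U V : O) : deq (Sigma01 n) U V <-> U = V.
Proof. split; [apply opens_ext | intros ->; simpl; tauto]. Qed.

Definition sub (U V : O) : Prop := forall x, proj1_sig U x -> proj1_sig V x.

(* Points are represented by their complements, the coatoms of the lattice. *)
Definition is_point (d : O) : Prop :=
  (exists U, ~ sub U d) /\ forall U, sub d U -> sub U d \/ forall W, sub W U.

Definition lies_in (d U : O) : Prop := is_point d /\ ~ sub U d.

Definition splits (V A B : O) : Prop := forall d,
  (lies_in d V <-> lies_in d A \/ lies_in d B) /\ ~ (lies_in d A /\ lies_in d B).

(* The points [p] and [a] lie in the same quasi-component of [V]. *)
Definition conn (V p a : O) : Prop :=
  lies_in p V /\ forall A B, splits V A B -> lies_in p A -> lies_in a A.

(* The points outside [G] form a discrete grid; the grid points in [D]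
   are the natural numbers; a grid point [p] is the pair of the numbers [a], [b]
   connected to [p] in [V] and in [H]; [S] contains the pairs [(a, a + 1)]. *)
Section GridEncoding.
Variables V H G D S : O.

Definition on_grid (p : O) : Prop := is_point p /\ ~ lies_in p G.
Definition is_num (a : O) : Prop := on_grid a /\ lies_in a D.
Definition rel (U a b : O) : Prop :=
  exists p, on_grid p /\ lies_in p U /\ conn V p a /\ conn H p b.
Definition zero (z : O) : Prop := is_num z /\ forall a, is_num a -> ~ rel S a z.

Definition discrete : Prop := forall d, on_grid d ->
  exists W, forall d', on_grid d' -> (lies_in d' W <-> d' = d).
Definition proj_unique (K : O) : Prop := forall p a a', on_grid p -> is_num a -> is_num a' ->
  conn K p a -> conn K p a' -> a = a'.
Definition pairs_exist : Prop := forall a b, is_num a -> is_num b ->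
  exists p, on_grid p /\ conn V p a /\ conn H p b.
Definition succ_total : Prop := forall a, is_num a -> exists b, is_num b /\ rel S a b.
Definition succ_functional : Prop := forall a b b', is_num a -> is_num b -> is_num b' ->
  rel S a b -> rel S a b' -> b = b'.
Definition succ_injective : Prop := forall a a' b, is_num a -> is_num a' -> is_num b ->
  rel S a b -> rel S a' b -> a = a'.
Definition induction_principle : Prop := exists z, zero z /\ forall U, lies_in z U ->
  (forall a b, is_num a -> is_num b -> lies_in a U -> rel S a b -> lies_in b U) ->
  forall a, is_num a -> lies_in a U.
(** A number is itself an open set. A spare point allows any open set to be altered, without
    changing its numbers, so that it is not a number and can stand for a set. *)
Definition other_point : Prop := exists q, is_point q /\ ~ is_num q.

Definition good : Prop :=
  discrete /\ proj_unique V /\ proj_unique H /\ pairs_exist /\ succ_total /\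
  succ_functional /\ succ_injective /\ induction_principle /\ other_point.

(* Addition and multiplication are intersections of all relations closed under the
   recursion equations, so that no function has to be quantified. *)
Definition add_rel (a b c : O) : Prop := forall F,
  (forall z, zero z -> rel F z a) ->
  (forall x y x' y', is_num x -> is_num y -> is_num x' -> is_num y' ->
     rel F x y -> rel S x x' -> rel S y y' -> rel F x' y') ->
  rel F b c.

Definition mul_rel (a b c : O) : Prop := forall F,
  (forall z, zero z -> rel F z z) ->
  (forall x y x' y', is_num x -> is_num y -> is_num x' -> is_num y' ->
     rel F x y -> rel S x x' -> add_rel y a y' -> rel F x' y') ->
  rel F b c.

Definition eq_int (x y : O) : Prop :=
  (is_num x /\ is_num y /\ x = y) \/
  (~ is_num x /\ ~ is_num y /\ forall a, is_num a -> (lies_in a x <-> lies_in a y)).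

Definition mem_int (x y : O) : Prop := is_num x /\ ~ is_num y /\ lies_in x y.
Definition add_int (x y z : O) : Prop := is_num x /\ is_num y /\ is_num z /\ add_rel x y z.
Definition mul_int (x y z : O) : Prop := is_num x /\ is_num y /\ is_num z /\ mul_rel x y z.

Fixpoint numeral (k : nat) (y : O) : Prop :=
  match k with
  | 0 => zero y
  | Datatypes.S k => is_num y /\ exists x, numeral k x /\ rel S x y
  end.
End GridEncoding.

(** * Definability of the grid predicates from inclusion *)

Lemma dfn_allL k (Q : O -> (nat -> O) -> Prop) :
  DfnL (S k) (fun r => Q (r 0) (fun i => r (S i))) ->
  DfnL k (fun rho => forall d, Q d rho).
Proof. exact (@dfn_all _ _ (Sigma01 n) k Q). Qed.

Lemma dfn_exL k (Q : O -> (nat -> O) -> Prop) :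
  DfnL (S k) (fun r => Q (r 0) (fun i => r (S i))) ->
  DfnL k (fun rho => exists d, Q d rho).
Proof. exact (@dfn_ex _ _ (Sigma01 n) k Q). Qed.

Lemma dfn_eqL k i j : i < k -> j < k -> DfnL k (fun rho => rho i = rho j).
Proof.
  intros I J. eapply dfn_ext; [|apply dfn_deq; [exact I | exact J]].
  intros rho. apply deq_opens.
Qed.

Lemma dfn_sub k i j : i < k -> j < k -> DfnL k (fun rho => sub (rho i) (rho j)).
Proof.
  intros I J. refine (dfn_rel lat_ar (Sigma01 n) LSub [i; j] eq_refl _). auto.
Qed.
Hint Resolve dfn_sub dfn_eqL : dfn.

Ltac dfnL := repeat first
  [ dfn_connective
  | lazymatch goal with
    | |- Dfn _ _ _ (fun rho => forall a : opens _, _) => apply dfn_allL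
    | |- Dfn _ _ _ (fun rho => exists a : opens _, _) => apply dfn_exL
    end
  | solve [auto 20 with dfn] ].

Lemma dfn_is_point k i : i < k -> DfnL k (fun rho => is_point (rho i)).
Proof. intros. unfold is_point. dfnL. Qed.
Hint Resolve dfn_is_point : dfn.

Lemma dfn_lies_in k i j : i < k -> j < k -> DfnL k (fun rho => lies_in (rho i) (rho j)).
Proof. intros. unfold lies_in. dfnL. Qed.
Hint Resolve dfn_lies_in : dfn.

Lemma dfn_conn k v p a : v < k -> p < k -> a < k ->
  DfnL k (fun rho => conn (rho v) (rho p) (rho a)).
Proof. intros. unfold conn, splits. dfnL. Qed.
Hint Resolve dfn_conn : dfn.

Lemma dfn_on_grid k g p : g < k -> p < k ->
  DfnL k (fun rho => on_grid (rho g) (rho p)).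
Proof. intros. unfold on_grid. dfnL. Qed.
Hint Resolve dfn_on_grid : dfn.

Lemma dfn_is_num k g d p : g < k -> d < k -> p < k ->
  DfnL k (fun rho => is_num (rho g) (rho d) (rho p)).
Proof. intros. unfold is_num. dfnL. Qed.
Hint Resolve dfn_is_num : dfn.

Lemma dfn_rel_int k v h g u a b : v < k -> h < k -> g < k -> u < k -> a < k -> b < k ->
  DfnL k (fun rho => rel (rho v) (rho h) (rho g) (rho u) (rho a) (rho b)).
Proof. intros. unfold rel. dfnL. Qed.
Hint Resolve dfn_rel_int : dfn.

Lemma dfn_zero k v h g d s z : v < k -> h < k -> g < k -> d < k -> s < k -> z < k ->
  DfnL k (fun rho => zero (rho v) (rho h) (rho g) (rho d) (rho s) (rho z)).
Proof. intros. unfold zero. dfnL. Qed.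
Hint Resolve dfn_zero : dfn.

Lemma dfn_add_rel k v h g d s x y z : v < k -> h < k -> g < k -> d < k -> s < k ->
  x < k -> y < k -> z < k ->
  DfnL k (fun rho => add_rel (rho v) (rho h) (rho g) (rho d) (rho s)
                       (rho x) (rho y) (rho z)).
Proof. intros. unfold add_rel. dfnL. Qed.
Hint Resolve dfn_add_rel : dfn.

Lemma dfn_mul_rel k v h g d s x y z : v < k -> h < k -> g < k -> d < k -> s < k ->
  x < k -> y < k -> z < k ->
  DfnL k (fun rho => mul_rel (rho v) (rho h) (rho g) (rho d) (rho s)
                       (rho x) (rho y) (rho z)).
Proof. intros. unfold mul_rel. dfnL. Qed.
Hint Resolve dfn_mul_rel : dfn.

Lemma dfn_good :
  DfnL 5 (fun rho => good (rho 0) (rho 1) (rho 2) (rho 3) (rho 4)).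
Proof.
  unfold good, discrete, proj_unique, pairs_exist, succ_total, succ_functional,
    succ_injective, induction_principle, other_point. dfnL.
Qed.

(** The arguments occupy the lowest indices in reverse order and the parameters [V], [H], [G], [D],
    [S] follow. Hence [G] and [D] have indices 4 and 5 here, and the parameters start at 3 in the
    ternary cases. *)
Lemma dfn_eq_int :
  DfnL 7 (fun rho => eq_int (rho 4) (rho 5) (rho 1) (rho 0)).
Proof. unfold eq_int. dfnL. Qed.

Lemma dfn_mem_int :
  DfnL 7 (fun rho => mem_int (rho 4) (rho 5) (rho 1) (rho 0)).
Proof. unfold mem_int. dfnL. Qed.

Lemma dfn_add_int :
  DfnL 8 (fun rho => add_int (rho 3) (rho 4) (rho 5) (rho 6) (rho 7)
                       (rho 2) (rho 1) (rho 0)).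
Proof. unfold add_int. dfnL. Qed.

Lemma dfn_mul_int :
  DfnL 8 (fun rho => mul_int (rho 3) (rho 4) (rho 5) (rho 6) (rho 7)
                       (rho 2) (rho 1) (rho 0)).
Proof. unfold mul_int. dfnL. Qed.

(** * Points as coatoms *)

Lemma compl_is_open (x : point n) : is_open (fun y => y <> x).
Proof.
  apply is_open_coord. intros y N.
  assert (E : exists i, y i <> x i).
  { apply NNPP. intros C. apply N, functional_extensionality. intros i.
    apply NNPP. eauto. }
  destruct E as [i E]. exists (Rabs (y i - x i)). split.
  - apply Rabs_pos_lt. lra.
  - intros z H ->. specialize (H i). lra.
Qed.

Definition compl (x : point n) : O := exist _ _ (@compl_is_open x).

Lemma compl_inj x y : compl x = compl y -> x = y.
Proof.
  intros E. apply NNPP. intros N.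
  assert (K : proj1_sig (compl y) x) by exact N. rewrite <- E in K. exact (K eq_refl).
Qed.

Lemma sub_compl U x : sub U (compl x) <-> ~ proj1_sig U x.
Proof.
  split.
  - intros H K. exact (H x K eq_refl).
  - intros N y K. simpl. intros ->. exact (N K).
Qed.

Lemma full_is_open : is_open (fun _ : point n => True).
Proof. apply is_open_coord. intros x _. exists 1%R. split; [lra | auto]. Qed.

(** A proper open set misses some [x] and is thus contained in [compl x]; maximality makes the two
    equal. *)
Lemma is_point_spec d : is_point d <-> exists x, d = compl x.
Proof.
  split.
  - intros [[U N] M]. apply not_all_ex_not in N as [x N].
    apply imply_to_and in N as [Ux N]. exists x.
    assert (L : sub d (compl x)) by (apply sub_compl, N).
    destruct (M (compl x) L) as [K|K].
    + apply opens_ext. intros y. split; [apply L | apply K].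
    + exfalso. exact (K (exist _ _ full_is_open) x I eq_refl).
  - intros [x ->]. split.
    + exists (exist _ _ full_is_open). rewrite sub_compl. simpl. tauto.
    + intros U L. destruct (classic (proj1_sig U x)) as [K|K].
      * right. intros W y _. destruct (classic (y = x)) as [->|N]; [exact K|].
        apply L, N.
      * left. apply sub_compl, K.
Qed.

Lemma lies_in_compl x U : lies_in (compl x) U <-> proj1_sig U x.
Proof.
  unfold lies_in. rewrite is_point_spec, sub_compl. split.
  - intros [_ K]. apply NNPP, K.
  - intros K. split; eauto.
Qed.

Lemma lies_in_union (F : O -> Prop) :
  exists U, forall d, lies_in d U <-> exists W, F W /\ lies_in d W.
Proof.
  assert (K : is_open (fun x => exists W, F W /\ proj1_sig W x)).
  { intros x [[W HW] [FW Wx]]. destruct (HW x Wx) as [eps [E B]].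
    exists eps. split; [exact E|]. intros y L. exists (exist _ W HW). split; auto.
    apply B, L. }
  exists (exist _ _ K). intros d. split.
  - intros L. pose proof (proj1 L) as P. apply is_point_spec in P as [x ->].
    apply lies_in_compl in L as [W [FW Wx]]. exists W. split; auto.
    apply lies_in_compl, Wx.
  - intros [W [FW L]]. pose proof (proj1 L) as P. apply is_point_spec in P as [x ->].
    apply lies_in_compl. exists W. split; auto. apply lies_in_compl, L.
Qed.

Lemma lies_in_point d a : is_point a -> (lies_in d a <-> is_point d /\ d <> a).
Proof.
  rewrite is_point_spec. intros [x ->]. split.
  - intros L. split; [apply L|]. intros ->. apply lies_in_compl in L. exact (L eq_refl).
  - intros [P N]. apply is_point_spec in P as [y ->]. apply lies_in_compl.
    intros ->. exact (N eq_refl).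
Qed.

Lemma lies_in_remove U q : is_point q ->
  exists U', forall d, lies_in d U' <-> lies_in d U /\ d <> q.
Proof.
  intros Q. destruct U as [U HU]. destruct q as [C HC].
  assert (K : is_open (fun x => U x /\ C x)).
  { intros x [Ux Cx]. destruct (HU x Ux) as [e [E B]]. destruct (HC x Cx) as [e' [E' B']].
    exists (Rmin e e'). split; [apply Rmin_glb_lt; assumption|].
    intros y L. pose proof (Rmin_l e e'). pose proof (Rmin_r e e').
    split; [apply B | apply B']; lra. }
  exists (exist _ _ K). intros d.
  destruct (classic (is_point d)) as [P|P]; [|unfold lies_in; tauto].
  pose proof (lies_in_point d Q) as L. apply is_point_spec in P as [x ->].
  rewrite lies_in_compl in L |- *. rewrite lies_in_compl. simpl in *.
  assert (is_point (compl x)) by (apply is_point_spec; eauto). tauto.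
Qed.

(** * Any parameters satisfying the axioms yield second-order arithmetic *)

Section Arithmetic.
Variables V H G D S : O.
Hypothesis Good : good V H G D S.
Notation is_num := (is_num G D).
Notation rel := (rel V H G).
Notation zero := (zero V H G D S).
Notation numeral := (numeral V H G D S).

(** The union of isolating neighbourhoods of the grid points in [Q] contains no other grid point.
    [Q] is arbitrary, definable or not, which makes the arithmetic obtained the full second-order
    one. *)
Lemma comprehension (Q : O -> Prop) :
  exists U, forall a, on_grid G a -> (lies_in a U <-> Q a).
Proof.
  destruct Good as [Disc _].
  destruct (lies_in_union (fun W => exists d, Q d /\
    forall d', on_grid G d' -> (lies_in d' W <-> d' = d))) as [U HU].
  exists U. intros a Ga. rewrite HU. split.
  - intros [W [[d [Qd HW]] L]]. apply HW in L as ->; assumption.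
  - intros Qa. destruct (Disc a Ga) as [W HW]. exists W. split; eauto.
    apply HW; auto.
Qed.

Lemma rel_comprehension (R : O -> O -> Prop) :
  exists F, forall a b, is_num a -> is_num b -> (rel F a b <-> R a b).
Proof.
  destruct Good as [_ [PV [PH [Pairs _]]]].
  destruct (comprehension (fun p => exists a b, is_num a /\ is_num b /\ conn V p a /\
    conn H p b /\ R a b)) as [F HF].
  exists F. intros a b Na Nb. split.
  - intros [p [Gp [L [Ca Cb]]]]. apply HF in L; auto.
    destruct L as [a' [b' [Na' [Nb' [Ca' [Cb' K]]]]]].
    rewrite (PV p a a'), (PH p b b'); auto.
  - intros K. destruct (Pairs a b Na Nb) as [p [Gp [Ca Cb]]].
    exists p. split; [exact Gp|]. split; [|auto]. apply HF; [exact Gp|].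
    exists a, b. auto.
Qed.

Lemma numeral_num k y : numeral k y -> is_num y.
Proof. destruct k; simpl; intros [K _]; exact K. Qed.

(** The standard numerals are an external set, but comprehension makes them an open set to which the
    internal induction axiom applies. *)
Lemma numeral_onto a : is_num a -> exists k, numeral k a.
Proof.
  intros Na. destruct (comprehension (fun a => exists k, numeral k a)) as [U HU].
  destruct Good as [_ [_ [_ [_ [_ [_ [_ [[z [Z Ind]] _]]]]]]]].
  apply HU; [apply Na|]. apply Ind; [| |exact Na].
  - apply HU; [apply Z|]. exists 0. exact Z.
  - intros x y Nx Ny L R. apply HU in L as [k K]; [|apply Nx].
    apply HU; [apply Ny|]. exists (Datatypes.S k). simpl. split; eauto.
Qed.

Lemma numeral_exists k : exists y, numeral k y.
Proof.
  destruct Good as [_ [_ [_ [_ [Tot [_ [_ [[z [Z _]] _]]]]]]]].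
  induction k as [|k [x X]]; [exists z; exact Z|].
  destruct (Tot x (numeral_num _ _ X)) as [y [Ny R]]. exists y. simpl. eauto.
Qed.

(** The set of [z0] and all successors is inductive, hence contains every number; a zero is no
    successor, so it is [z0]. *)
Lemma zero_unique z z' : zero z -> zero z' -> z = z'.
Proof.
  destruct Good as [_ [_ [_ [_ [_ [_ [_ [[z0 [Z Ind]] _]]]]]]]].
  assert (K : forall z', zero z' -> z' = z0).
  { intros y Y.
    destruct (comprehension (fun a => a = z0 \/ exists x, is_num x /\ rel S x a)) as [U HU].
    assert (L : lies_in y U).
    { apply Ind; [| |apply Y].
      - apply HU; [apply Z | auto].
      - intros a b Na Nb _ R. apply HU; [apply Nb | eauto]. }
    apply HU in L; [|apply Y]. destruct L as [L|[x [Nx R]]]; auto.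
    exfalso. exact (proj2 Y x Nx R). }
  intros A B. rewrite (K _ A), (K _ B). reflexivity.
Qed.

Lemma numeral_functional k y y' : numeral k y -> numeral k y' -> y = y'.
Proof.
  destruct Good as [_ [_ [_ [_ [_ [Fun _]]]]]].
  revert y y'. induction k as [|k IH]; simpl; intros y y'; [apply zero_unique|].
  intros [Ny [x [X R]]] [Ny' [x' [X' R']]].
  rewrite (IH x' x X' X) in R'.
  exact (Fun x y y' (numeral_num _ _ X) Ny Ny' R R').
Qed.

Lemma numeral_injective j k y : numeral j y -> numeral k y -> j = k.
Proof.
  destruct Good as [_ [_ [_ [_ [_ [_ [Inj _]]]]]]].
  revert k y. induction j as [|j IH]; intros [|k] y; cbn [LatticePredicates.numeral]; auto.
  - intros [_ Z] [_ [x [X R]]]. exfalso. exact (Z x (numeral_num _ _ X) R).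
  - intros [_ [x [X R]]] [_ Z]. exfalso. exact (Z x (numeral_num _ _ X) R).
  - intros [Ny [x [X R]]] [_ [x' [X' R']]]. f_equal. apply (IH k x X).
    rewrite (Inj x x' y (numeral_num _ _ X) (numeral_num _ _ X') Ny R R'). exact X'.
Qed.

Lemma numeral_succ j k x y : numeral j x -> numeral k y ->
  (rel S x y <-> k = Datatypes.S j).
Proof.
  intros J K. split.
  - intros R. apply (@numeral_injective _ _ y K). simpl. split; eauto using numeral_num.
  - intros ->. destruct K as [_ [x' [X R]]].
    rewrite (numeral_functional _ _ _ J X). exact R.
Qed.

Lemma numeral_rel (R : nat -> nat -> Prop) : exists F, forall i j x y,
  numeral i x -> numeral j y -> (rel F x y <-> R i j).
Proof.
  destruct (rel_comprehension (fun x y => exists i j, numeral i x /\ numeral j y /\ R i j))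
    as [F HF].
  exists F. intros i j x y I J. rewrite HF by eauto using numeral_num. split; [|eauto].
  intros [i' [j' [I' [J' K]]]].
  rewrite (numeral_injective _ _ _ I I'), (numeral_injective _ _ _ J J'). exact K.
Qed.

(** Forwards, the true graph of addition is itself one of the relations [F]. Backwards, every [F]
    closed under the recursion contains the graph, by induction on [j]. *)
Lemma numeral_add i j k x y z : numeral i x -> numeral j y -> numeral k z ->
  (add_rel V H G D S x y z <-> i + j = k).
Proof.
  intros X Y Z. split.
  - intros A. destruct (numeral_rel (fun s t => t = i + s)) as [F HF].
    enough (E : k = i + j) by auto. apply (HF _ _ _ _ Y Z). apply A.
    + intros o Zo. apply (HF 0 i); auto.
    + intros a b a' b' Na Nb Na' Nb' R Ra Rb.
      apply numeral_onto in Na as [s Ks]. apply numeral_onto in Nb as [t Kt].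
      apply numeral_onto in Na' as [s' Ks']. apply numeral_onto in Nb' as [t' Kt'].
      apply (HF _ _ _ _ Ks Kt) in R. apply (HF _ _ _ _ Ks' Kt').
      apply (numeral_succ _ _ _ _ Ks Ks') in Ra.
      apply (numeral_succ _ _ _ _ Kt Kt') in Rb. lia.
  - intros E F Base Step. subst k. revert y z Y Z.
    induction j as [|j IH]; intros y z Y Z.
    + rewrite Nat.add_0_r in Z. rewrite (numeral_functional _ _ _ Z X). apply Base, Y.
    + destruct (numeral_exists j) as [y0 Y0]. destruct (numeral_exists (i + j)) as [z0 Z0].
      apply (Step y0 z0); eauto using numeral_num.
      * apply (numeral_succ _ _ _ _ Y0 Y). reflexivity.
      * apply (numeral_succ _ _ _ _ Z0 Z). lia.
Qed.

Lemma numeral_mul i j k x y z : numeral i x -> numeral j y -> numeral k z ->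
  (mul_rel V H G D S x y z <-> i * j = k).
Proof.
  intros X Y Z. split.
  - intros A. destruct (numeral_rel (fun s t => t = i * s)) as [F HF].
    enough (E : k = i * j) by auto. apply (HF _ _ _ _ Y Z). apply A.
    + intros o Zo. apply (HF 0 0); auto.
    + intros a b a' b' Na Nb Na' Nb' R Ra Rb.
      apply numeral_onto in Na as [s Ks]. apply numeral_onto in Nb as [t Kt].
      apply numeral_onto in Na' as [s' Ks']. apply numeral_onto in Nb' as [t' Kt'].
      apply (HF _ _ _ _ Ks Kt) in R. apply (HF _ _ _ _ Ks' Kt').
      apply (numeral_succ _ _ _ _ Ks Ks') in Ra.
      apply (numeral_add _ _ _ _ _ _ Kt X Kt') in Rb.
      subst. lia.
  - intros E F Base Step. subst k. revert y z Y Z.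
    induction j as [|j IH]; intros y z Y Z.
    + rewrite Nat.mul_0_r in Z. rewrite (numeral_functional 0 _ _ Z Y). apply Base, Y.
    + destruct (numeral_exists j) as [y0 Y0]. destruct (numeral_exists (i * j)) as [z0 Z0].
      apply (Step y0 z0); eauto using numeral_num.
      * apply (numeral_succ _ _ _ _ Y0 Y). reflexivity.
      * apply (numeral_add _ _ _ _ _ _ Z0 X Z). lia.
Qed.

Definition represents (y : O) (d : N2dom) : Prop :=
  match d with
  | inl k => numeral k y
  | inr X => ~ is_num y /\ forall a k, numeral k a -> (lies_in a y <-> X k)
  end.

Lemma represents_total y : exists d, represents y d.
Proof.
  destruct (classic (is_num y)) as [N|N].
  - apply numeral_onto in N as [k K]. exists (inl k). exact K.
  - exists (inr (fun k => exists a, numeral k a /\ lies_in a y)). split; auto.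
    intros a k K. split; [eauto|]. intros [a' [K' L]].
    rewrite (numeral_functional _ _ _ K K'). exact L.
Qed.

Lemma represents_onto d : exists y, represents y d.
Proof.
  destruct d as [k|X]; [apply numeral_exists|].
  destruct (comprehension (fun a => exists k, numeral k a /\ X k)) as [U HU].
  destruct Good as [_ [_ [_ [_ [_ [_ [_ [_ [q [Pq Nq]]]]]]]]]].
  (* Removing a point that is no number makes [U] differ from every number. *)
  destruct (lies_in_remove U Pq) as [U' HU'].
  exists U'. split.
  (* A coatom misses only its own point. As [U'] misses [q], it could be a number only by being
     [q]. *)
  - intros N. apply Nq. assert (E : q = U'); [|rewrite E; exact N].
    apply NNPP. intros E. assert (L : lies_in q U').
    { apply lies_in_point; [apply N|]. auto. }
    apply HU' in L as [_ L]. auto.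
  - intros a k K. rewrite HU'. pose proof (numeral_num _ _ K) as N.
    rewrite HU by apply N. split.
    + intros [[k' [K' Xk]] _]. rewrite (numeral_injective _ _ _ K K'). exact Xk.
    + intros Xk. split; [eauto|]. intros ->. auto.
Qed.

Lemma represents_num y d : represents y d -> (is_num y <-> n2_rel NNat [d]).
Proof.
  destruct d as [k|X]; simpl.
  - intros K. apply numeral_num in K. tauto.
  - tauto.
Qed.

Lemma represents_eq y0 y1 d0 d1 : represents y0 d0 -> represents y1 d1 ->
  (eq_int G D y0 y1 <-> n2_eq d0 d1).
Proof.
  intros R0 R1. unfold eq_int.
  rewrite (represents_num _ _ R0), (represents_num _ _ R1).
  destruct d0 as [j|X], d1 as [k|Y]; simpl in *; try tauto.
  - split.
    + intros [[_ [_ ->]]|[[] _]]; [|exact I]. exact (numeral_injective _ _ _ R0 R1).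
    + intros ->. left. repeat split. exact (numeral_functional _ _ _ R0 R1).
  - destruct R0 as [_ R0], R1 as [_ R1]. split.
    + intros [[[] _]|[_ [_ K]]] k. destruct (numeral_exists k) as [a A].
      rewrite <- (R0 _ _ A), <- (R1 _ _ A). apply K, (numeral_num _ _ A).
    + intros E. right. split; [tauto|]. split; [tauto|]. intros a Na.
      apply numeral_onto in Na as [k K]. rewrite (R0 _ _ K), (R1 _ _ K). apply E.
Qed.

Lemma represents_mem y0 y1 d0 d1 : represents y0 d0 -> represents y1 d1 ->
  (mem_int G D y0 y1 <-> n2_rel NIn [d0; d1]).
Proof.
  intros R0 R1. unfold mem_int.
  rewrite (represents_num _ _ R0), (represents_num _ _ R1).
  destruct d0 as [j|X], d1 as [k|Y]; simpl in *; try tauto.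
  destruct R1 as [_ R1]. rewrite (R1 _ _ R0). tauto.
Qed.

Lemma represents_add y0 y1 y2 d0 d1 d2 :
  represents y0 d0 -> represents y1 d1 -> represents y2 d2 ->
  (add_int V H G D S y0 y1 y2 <-> n2_rel NAdd [d0; d1; d2]).
Proof.
  intros R0 R1 R2. unfold add_int.
  rewrite (represents_num _ _ R0), (represents_num _ _ R1), (represents_num _ _ R2).
  destruct d0 as [i|X], d1 as [j|Y], d2 as [k|Z]; simpl in *; try tauto.
  rewrite (numeral_add _ _ _ _ _ _ R0 R1 R2). tauto.
Qed.

Lemma represents_mul y0 y1 y2 d0 d1 d2 :
  represents y0 d0 -> represents y1 d1 -> represents y2 d2 ->
  (mul_int V H G D S y0 y1 y2 <-> n2_rel NMul [d0; d1; d2]).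
Proof.
  intros R0 R1 R2. unfold mul_int.
  rewrite (represents_num _ _ R0), (represents_num _ _ R1), (represents_num _ _ R2).
  destruct d0 as [i|X], d1 as [j|Y], d2 as [k|Z]; simpl in *; try tauto.
  rewrite (numeral_mul _ _ _ _ _ _ R0 R1 R2). tauto.
Qed.
End Arithmetic.
End LatticePredicates.

(** * The grid model *)

Section Model.
Variables (n : nat) (i0 i1 : Fin.t n).
Hypotheses (idx0 : idx i0 = 0) (idx1 : idx i1 = 1).
Open Scope R_scope.

Definition locally_constant (P : R -> Prop) : Prop := forall s,
  exists eps, 0 < eps /\ forall s', Rabs (s - s') < eps -> (P s <-> P s').

(** Connectedness of the line: local constancy carries [P] to the supremum of the points up to which
    it holds from [a] on, and then past it, unless [b] has been reached. *)
Lemma locally_constant_right P a b :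
  locally_constant P -> a <= b -> P a -> P b.
Proof.
  intros C L Pa.
  pose (E := fun s => a <= s <= b /\ forall u, a <= u <= s -> P u).
  assert (Ea : E a).
  { split; [lra|]. intros u U. replace u with a by lra. exact Pa. }
  destruct (completeness E) as [m [U M]].
  { exists b. intros s [S _]. lra. }
  { exists a. exact Ea. }
  assert (Lm : a <= m <= b).
  { split; [apply U, Ea|]. apply M. intros s [S _]. lra. }
  destruct (C m) as [eps [Pe H]].
  assert (S : exists s, E s /\ m - eps < s).
  { apply NNPP. intros N. assert (W : is_upper_bound E (m - eps)).
    { intros s Es. destruct (Rle_lt_dec s (m - eps)); [assumption|].
      exfalso. eauto. }
    apply M in W. lra. }
  destruct S as [s [Es Ls]]. assert (Ls' : s <= m) by (apply U, Es).
  assert (Pm : P m).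
  { apply (H s). { apply Rabs_def1; lra. } apply Es. destruct Es. lra. }
  assert (K : forall u, a <= u -> u < m + eps -> P u).
  { intros u U1 U2. destruct (Rle_lt_dec u s) as [Q|Q]; [apply Es; lra|].
    apply (H u); [apply Rabs_def1; lra | exact Pm]. }
  destruct (Rle_lt_dec b (m + eps / 2)) as [Q|Q]; [apply K; lra|].
  assert (W : E (m + eps / 2)).
  { split; [lra|]. intros u [U1 U2]. apply K; lra. }
  apply U in W. lra.
Qed.

Lemma locally_constant_all P a b : locally_constant P -> P a -> P b.
Proof.
  intros C Pa. destruct (Rle_lt_dec a b) as [L|L].
  - exact (locally_constant_right C L Pa).
  - apply NNPP. intros N.
    (* Moving left from [a] to [b] is moving right from [b] to [a] with the negation, which is
       locally constant too. *)
    refine (@locally_constant_right (fun s => ~ P s) b a _ _ N Pa); [|lra].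
    intros s. destruct (C s) as [eps [E H]]. exists eps. split; [exact E|].
    intros s' S. specialize (H s' S). tauto.
Qed.

Definition near (x : R) (a : nat) : Prop := Rabs (x - INR a) < 1 / 2.

Lemma near_unique x a b : near x a -> near x b -> a = b.
Proof.
  unfold near. intros A B. apply Rabs_def2 in A. apply Rabs_def2 in B.
  assert (D : forall c d : nat, INR c < INR d + 1 -> (c <= d)%nat).
  { intros c d L. rewrite <- S_INR in L. apply INR_lt in L. lia. }
  apply Nat.le_antisymm; apply D; lra.
Qed.

Lemma near_INR a : near (INR a) a.
Proof. unfold near. rewrite Rminus_diag, Rabs_R0. lra. Qed.

Lemma near_INR_eq a b : near (INR a) b -> a = b.
Proof. intros H. exact (near_unique (near_INR a) H). Qed.

Lemma near_open x a : near x a ->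
  exists eps, 0 < eps /\ forall y, Rabs (x - y) < eps -> near y a.
Proof.
  unfold near. intros N. exists (1 / 2 - Rabs (x - INR a)). split; [lra|].
  intros y L. replace (y - INR a) with (- (x - y) + (x - INR a)) by ring.
  pose proof (Rabs_triang (- (x - y)) (x - INR a)) as T. rewrite Rabs_Ropp in T. lra.
Qed.

(** Unit boxes around different pairs are disjoint and each contains one grid point, so any binary
    relation [Q] is cut out of the grid by an open set. *)
Definition in_box (Q : nat -> nat -> Prop) (x : point n) : Prop :=
  exists a b, Q a b /\ near (x i0) a /\ near (x i1) b.

Lemma in_box_open Q : is_open (in_box Q).
Proof.
  apply is_open_coord. intros x [a [b [Qab [A B]]]].
  destruct (near_open A) as [e [E H]]. destruct (near_open B) as [e' [E' H']].
  exists (Rmin e e'). split; [apply Rmin_glb_lt; assumption|].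
  intros y L. exists a, b. pose proof (Rmin_l e e'). pose proof (Rmin_r e e').
  pose proof (L i0). pose proof (L i1).
  split; [exact Qab|]. split; [apply H | apply H']; lra.
Qed.

Definition box (Q : nat -> nat -> Prop) : opens n := exist _ _ (@in_box_open Q).

Definition in_strip (i : Fin.t n) (Q : nat -> Prop) (x : point n) : Prop :=
  exists a, Q a /\ near (x i) a.

Lemma in_strip_open i Q : is_open (in_strip i Q).
Proof.
  apply is_open_coord. intros x [a [Qa A]]. destruct (near_open A) as [e [E H]].
  exists e. split; [exact E|]. intros y L. exists a. auto.
Qed.

Definition strip (i : Fin.t n) (Q : nat -> Prop) : opens n :=
  exist _ _ (@in_strip_open i Q).

Definition grid (a b : nat) : point n := fun i =>
  match idx i with 0%nat => INR a | 1%nat => INR b | _ => 0 end.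

Lemma grid0 a b : grid a b i0 = INR a.
Proof. unfold grid. rewrite idx0. reflexivity. Qed.

Lemma grid1 a b : grid a b i1 = INR b.
Proof. unfold grid. rewrite idx1. reflexivity. Qed.

Lemma grid_inj a b a' b' : grid a b = grid a' b' -> a = a' /\ b = b'.
Proof.
  intros E. split; apply INR_eq.
  - rewrite <- (grid0 a b), E. apply grid0.
  - rewrite <- (grid1 a b), E. apply grid1.
Qed.

Lemma off_grid_open : is_open (fun x => ~ exists a b, x = grid a b).
Proof.
  apply is_open_coord. intros x N.
  (* Inside the box of [(a, b)] the only grid point to avoid is [grid a b], which differs from [x]
     in some coordinate. Outside all boxes every grid point is at least 1/2 away in one of the first
     two coordinates. *)
  destruct (classic (in_box (fun _ _ => True) x)) as [[a [b [_ [A B]]]]|M].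
  - assert (D : exists i, x i <> grid a b i).
    { apply NNPP. intros C. apply N. exists a, b. apply functional_extensionality.
      intros i. apply NNPP. eauto. }
    destruct D as [i D].
    destruct (in_box_open (Q := fun a' b' => a' = a /\ b' = b) (x := x)) as [e [E K]].
    { exists a, b. auto. }
    destruct (edist_small n E) as [d [Pd Kd]].
    exists (Rmin d (Rabs (x i - grid a b i))). split.
    { apply Rmin_glb_lt; [exact Pd|]. apply Rabs_pos_lt. lra. }
    intros y L [a' [b' ->]].
    pose proof (Rmin_l d (Rabs (x i - grid a b i))).
    pose proof (Rmin_r d (Rabs (x i - grid a b i))).
    destruct (K (grid a' b')) as [a2 [b2 [[-> ->] [A2 B2]]]].
    { apply Kd. intros j. specialize (L j). lra. }
    rewrite grid0 in A2. rewrite grid1 in B2.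
    apply near_INR_eq in A2 as ->. apply near_INR_eq in B2 as ->.
    specialize (L i). lra.
  - exists (1 / 2). split; [lra|]. intros y L [a [b ->]]. apply M.
    exists a, b. split; [exact I|]. unfold near.
    rewrite <- (grid0 a b) at 1. rewrite <- (grid1 a b). auto.
Qed.

Definition off_grid : opens n := exist _ _ off_grid_open.

Lemma splits_points V A B : splits V A B -> forall x : point n,
  (proj1_sig V x <-> proj1_sig A x \/ proj1_sig B x) /\
  ~ (proj1_sig A x /\ proj1_sig B x).
Proof. intros H x. specialize (H (compl x)). rewrite !lies_in_compl in H. exact H. Qed.

Lemma points_split V A B : (forall x : point n,
  (proj1_sig V x <-> proj1_sig A x \/ proj1_sig B x) /\
  ~ (proj1_sig A x /\ proj1_sig B x)) -> splits V A B.
Proof.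
  intros H d. destruct (classic (is_point d)) as [P|P]; [|unfold lies_in; tauto].
  apply is_point_spec in P as [x ->]. rewrite !lies_in_compl. apply H.
Qed.

Notation full_strip i := (strip i (fun _ => True)).

(** Strips around different numbers are disjoint, so one strip against all the others is a splitting
    that isolates the strip of [x]. *)
Lemma conn_strip_same i x y a : near (x i) a ->
  conn (full_strip i) (compl x) (compl y) -> near (y i) a.
Proof.
  intros A [_ C].
  assert (S : splits (full_strip i) (strip i (fun b => b = a)) (strip i (fun b => b <> a))).
  { apply points_split. intros z. simpl. split.
    - split.
      + intros [b [_ B]]. destruct (Nat.eq_dec b a) as [E|N]; [left | right]; exists b; auto.
      + intros [[b [_ B]]|[b [_ B]]]; exists b; auto.
    - intros [[b [-> B]] [c [N K]]]. apply N. exact (near_unique K B). }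
  apply C in S.
  - apply lies_in_compl in S as [b [-> B]]. exact B.
  - apply lies_in_compl. exists a. auto.
Qed.

(** The line through [x] and [y] in direction [j] stays in the strip, as coordinate [i] is fixed on
    it. A splitting of the strips restricts to a locally constant predicate on this line. *)
Lemma conn_strip_line i j (x y : point n) a : j <> i -> near (x i) a ->
  (forall t, t <> j -> x t = y t) -> conn (full_strip i) (compl x) (compl y).
Proof.
  intros N A E. split; [apply lies_in_compl; exists a; auto|].
  intros U W S L. apply lies_in_compl in L. apply lies_in_compl.
  pose proof (splits_points S) as Sp.
  pose (line := fun (s : R) (t : Fin.t n) => if Fin.eq_dec t j then s else x t).
  assert (Lx : line (x j) = x).
  { apply functional_extensionality. intros t. unfold line.
    destruct (Fin.eq_dec t j) as [->|]; reflexivity. }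
  assert (Ly : line (y j) = y).
  { apply functional_extensionality. intros t. unfold line.
    destruct (Fin.eq_dec t j) as [->|]; auto. }
  rewrite <- Ly. rewrite <- Lx in L. revert L.
  apply (@locally_constant_all (fun s => proj1_sig U (line s))).
  assert (O : forall (X : opens n) s, proj1_sig X (line s) -> exists eps, 0 < eps /\
    forall s', Rabs (s - s') < eps -> proj1_sig X (line s')).
  { intros [X HX] s H. simpl in *. destruct (is_open_coord_inv _ HX H) as [eps [P K]].
    exists eps. split; [exact P|]. intros s' L. apply K. intros t. unfold line.
    destruct (Fin.eq_dec t j); [exact L|]. rewrite Rminus_diag, Rabs_R0. exact P. }
  assert (V : forall s, proj1_sig U (line s) \/ proj1_sig W (line s)).
  { intros s. apply Sp. exists a. split; [exact I|]. unfold line.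
    destruct (Fin.eq_dec i j) as [->|]; [congruence | exact A]. }
  intros s. destruct (V s) as [H|H].
  - destruct (O U s H) as [eps [P K]]. exists eps. split; [exact P|].
    intros s' L. split; auto.
  - destruct (O W s H) as [eps [P K]]. exists eps. split; [exact P|].
    intros s' L. specialize (K s' L). pose proof (proj2 (Sp (line s))).
    pose proof (proj2 (Sp (line s'))). tauto.
Qed.

Lemma on_grid_spec d : on_grid off_grid d <-> exists a b, d = compl (grid a b).
Proof.
  unfold on_grid. rewrite is_point_spec. split.
  - intros [[x ->] N]. rewrite lies_in_compl in N. simpl in N.
    apply NNPP in N as [a [b ->]]. eauto.
  - intros [a [b ->]]. split; [eauto|]. rewrite lies_in_compl. simpl. eauto 6.
Qed.

Lemma box_grid Q a b : lies_in (compl (grid a b)) (box Q) <-> Q a b.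
Proof.
  rewrite lies_in_compl. simpl. split.
  - intros [a' [b' [H [A B]]]]. rewrite grid0 in A. rewrite grid1 in B.
    apply near_INR_eq in A as ->. apply near_INR_eq in B as ->. exact H.
  - intros H. exists a, b. rewrite grid0, grid1. auto using near_INR.
Qed.

Notation diagonal := (box (fun a b => a = b)).
Notation succ_box := (box (fun a b => b = S a)).
Notation strip0 := (full_strip i0).
Notation strip1 := (full_strip i1).

Lemma num_grid d : is_num off_grid diagonal d <-> exists k, d = compl (grid k k).
Proof.
  unfold is_num. rewrite on_grid_spec. split.
  - intros [[a [b ->]] L]. apply box_grid in L as ->. eauto.
  - intros [k ->]. split; [eauto|]. apply box_grid. reflexivity.
Qed.

Lemma idx_neq : i0 <> i1.
Proof. intros E. rewrite E, idx1 in idx0. discriminate. Qed.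

(** Grid points of the same column differ only in the coordinate [i1], and a line in that direction
    joins them. *)
Lemma conn0_grid a b k l :
  conn strip0 (compl (grid a b)) (compl (grid k l)) <-> a = k.
Proof.
  split.
  - intros C. apply conn_strip_same with (a := a) in C.
    + rewrite grid0 in C. apply near_INR_eq in C. auto.
    + rewrite grid0. apply near_INR.
  - intros ->. apply conn_strip_line with (j := i1) (a := k).
    + intros E. exact (idx_neq (eq_sym E)).
    + rewrite grid0. apply near_INR.
    + intros t T. unfold grid. destruct (idx t) as [|[|]] eqn:Et; auto.
      exfalso. apply T, idx_inj. congruence.
Qed.

Lemma conn1_grid a b k l :
  conn strip1 (compl (grid a b)) (compl (grid k l)) <-> b = l.
Proof.
  split.
  - intros C. apply conn_strip_same with (a := b) in C.
    + rewrite grid1 in C. apply near_INR_eq in C. auto.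
    + rewrite grid1. apply near_INR.
  - intros ->. apply conn_strip_line with (j := i0) (a := l).
    + exact idx_neq.
    + rewrite grid1. apply near_INR.
    + intros t T. unfold grid. destruct (idx t) as [|[|]] eqn:Et; auto.
      exfalso. apply T, idx_inj. congruence.
Qed.

Lemma rel_grid U k l :
  rel strip0 strip1 off_grid U (compl (grid k k)) (compl (grid l l)) <->
  lies_in (compl (grid k l)) U.
Proof.
  split.
  - intros [p [P [L [C0 C1]]]]. apply on_grid_spec in P as [a [b ->]].
    apply conn0_grid in C0 as ->. apply conn1_grid in C1 as ->. exact L.
  - intros L. exists (compl (grid k l)). split; [apply on_grid_spec; eauto|].
    split; [exact L|]. split; [apply conn0_grid | apply conn1_grid]; reflexivity.
Qed.

Lemma succ_grid k l :
  rel strip0 strip1 off_grid succ_box (compl (grid k k)) (compl (grid l l)) <-> l = S k.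
Proof. rewrite rel_grid. exact (box_grid (fun a b => b = S a) k l). Qed.

Lemma compl_grid_eq k l : compl (grid k k) = compl (grid l l) <-> k = l.
Proof.
  split; [|congruence]. intros E. apply compl_inj in E. apply (grid_inj E).
Qed.

Lemma grid_good : good strip0 strip1 off_grid diagonal succ_box.
Proof.
  repeat split.
  - intros d Gd. apply on_grid_spec in Gd as [a [b ->]].
    exists (box (fun a' b' => a' = a /\ b' = b)). intros d' Gd'.
    apply on_grid_spec in Gd' as [a' [b' ->]]. rewrite box_grid. split.
    + intros [-> ->]. reflexivity.
    + intros E. apply compl_inj in E. apply grid_inj in E. exact E.
  - intros p a a' Gp Na Na' C C'. apply on_grid_spec in Gp as [x [y ->]].
    apply num_grid in Na as [k ->]. apply num_grid in Na' as [l ->].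
    apply conn0_grid in C as <-. apply conn0_grid in C' as <-. reflexivity.
  - intros p a a' Gp Na Na' C C'. apply on_grid_spec in Gp as [x [y ->]].
    apply num_grid in Na as [k ->]. apply num_grid in Na' as [l ->].
    apply conn1_grid in C as <-. apply conn1_grid in C' as <-. reflexivity.
  - intros a b Na Nb. apply num_grid in Na as [k ->]. apply num_grid in Nb as [l ->].
    exists (compl (grid k l)). split; [apply on_grid_spec; eauto|].
    split; [apply conn0_grid | apply conn1_grid]; reflexivity.
  - intros a Na. apply num_grid in Na as [k ->]. exists (compl (grid (S k) (S k))).
    split; [apply num_grid; eauto | apply succ_grid; reflexivity].
  - intros a b b' Na Nb Nb' R R'. apply num_grid in Na as [k ->].
    apply num_grid in Nb as [l ->]. apply num_grid in Nb' as [l' ->].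
    apply succ_grid in R as ->. apply succ_grid in R' as ->. reflexivity.
  - intros a a' b Na Na' Nb R R'. apply num_grid in Na as [k ->].
    apply num_grid in Na' as [k' ->]. apply num_grid in Nb as [l ->].
    apply succ_grid in R as ->. apply succ_grid in R' as E. apply compl_grid_eq. lia.
  - exists (compl (grid 0 0)). split.
    + split; [apply num_grid; eauto|]. intros a Na R.
      apply num_grid in Na as [k ->]. apply succ_grid in R. discriminate.
    + intros U Z Step a Na. apply num_grid in Na as [k ->].
      induction k as [|k IH]; [exact Z|].
      eapply Step; [| |exact IH|]; try (apply num_grid; eauto).
      apply succ_grid. reflexivity.
  (* Any point off the diagonal serves as the spare point. *)
  - exists (compl (grid 0 1)). split; [apply is_point_spec; eauto|].
    intros N. apply num_grid in N as [k E]. apply compl_inj, grid_inj in E. lia.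
Qed.
End Model.

Theorem N2_le_lattice n : 2 <= n ->
  many_one_le (FO n2_ar n2_code N2) (FO lat_ar lat_code (Sigma01 n)).
Proof.
  intros L.
  destruct (idx_onto (n := n) (k := 0)) as [i0 I0]; [lia|].
  destruct (idx_onto (n := n) (k := 1)) as [i1 I1]; [lia|].
  destruct (dfn_good n) as [ax [Wax [Cax Hax]]].
  destruct (dfn_eq_int n) as [fe [We [Ce He]]].
  destruct (dfn_mem_int n) as [fi [Wi [Ci Hi]]].
  destruct (dfn_add_int n) as [fa [Wa [Ca Ha]]].
  destruct (dfn_mul_int n) as [fm [Wm [Cm Hm]]].
  (* One argument and five parameters: the argument has index 0, so [G] and [D] sit at 3 and 4. *)
  destruct (@dfn_is_num n 6 3 4 0) as [fn [Wn [Cn Hn]]]; try lia.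
  pose (sig := fun s => match s with
    | NNat => fn | NSet => fNot fn | NIn => fi | NAdd => fa | NMul => fm end).
  pose (rep := fun p : nat -> opens n => represents (p 0) (p 1) (p 2) (p 3) (p 4)).
  refine (@interpretation_reduction N2Sym LatSym n2_ar n2_code lat_ar lat_code
    N2 (Sigma01 n) _ _ [NNat; NSet; NIn; NAdd; NMul] _ 5 ax fe sig
    Wax Cax We Ce _ _ (@deq_opens n) rep _ _ _ _ _).
  - intros [] []; simpl; congruence.
  - intros [] []; reflexivity.
  - intros []; simpl; auto 6.
  - intros []; simpl; assumption.
  - intros []; simpl; assumption.
  - exists (prepend [strip i0 (fun _ => True); strip i1 (fun _ => True);
      off_grid i0 i1 I0 I1; box i0 i1 (fun a b => a = b); box i0 i1 (fun a b => b = S a)]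
      (fun _ => off_grid i0 i1 I0 I1)).
    apply Hax. exact (grid_good i0 i1 I0 I1).
  - intros p A y. apply Hax in A. exact (represents_total A y).
  - intros p A d. apply Hax in A. exact (represents_onto A d).
  - intros p A rho Ag y0 y1 d0 d1 R0 R1. apply Hax in A. rewrite He. cbn.
    rewrite !Ag by lia. exact (represents_eq A _ _ _ _ R0 R1).
  - intros p A rho Ag s ys ds Ly F. apply Hax in A.
    destruct s; cbn in Ly; destruct F as [|y0 d0 ys ds R0 F]; try discriminate;
      destruct F as [|y1 d1 ys ds R1 F]; try discriminate;
      try (destruct F as [|y2 d2 ys ds R2 F]; try discriminate);
      try (destruct F as [|y3 d3 ys ds R3 F]; try discriminate); cbn [sig].
    + rewrite Hn. cbn. rewrite !Ag by lia. exact (represents_num _ _ _ _ _ _ _ R0).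
    + cbn [sat]. rewrite Hn. cbn. rewrite !Ag by lia.
      rewrite (represents_num _ _ _ _ _ _ _ R0). destruct d0; simpl; tauto.
    + rewrite Hi. cbn. rewrite !Ag by lia. exact (represents_mem _ _ _ _ _ _ _ _ _ R0 R1).
    + rewrite Ha. cbn. rewrite !Ag by lia. exact (represents_add A _ _ _ _ _ _ R0 R1 R2).
    + rewrite Hm. cbn. rewrite !Ag by lia. exact (represents_mul A _ _ _ _ _ _ R0 R1 R2).
Qed.

Theorem theorem3p2 (n : nat) (hn : 2 <= n) :
  many_one_equiv (FO lat_ar lat_code (Sigma01 n)) (FO n2_ar n2_code N2).
Proof.
  split.
  - apply lattice_le_N2. lia.
  - apply N2_le_lattice, hn.
Qed.
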